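(* There exists a universal constant $L>1$ with the following properties. (1) If $\gamma\subset\mathbb{R}^3$ is a $C^{1,1}$ $1$-manifold and $x\in\gamma$, then there exists a neighborhood $U\subset\gamma$ of $x$ such that $\mathrm{Lip}((U,d_K),\mathbb{R}^4)\le L$. (2) If $M\subset\mathbb{R}^3$ is a $C^{1,1}$ $2$-manifold and $x\in M$ is $\mathbb{H}$-regular, then there exists a neighborhood $U\subset M$ of $x$ such that $\mathrm{Lip}((U,d_K),\mathbb{R}^4)\le L$.
   Context: On $\mathbb{R}^3$ consider the vector fields $X=\partial_x-\tfrac12y\partial_z$, $Y=\partial_y+\tfrac12x\partial_z$; the horizontal plane at $p$ is $H_p=\mathrm{span}\{X(p),Y(p)\}$. For a $C^{1,1}$ $2$-manifold $M\subset\mathbb{R}^3$ and $p\in M$, $p$ is characteristic if $T_pM=H_p$, and $\mathbb{H}$-regular otherwise. The Korányi metric is $d_K(p,q)=\big(((x-x')^2+(y-y')^2)^2+16(z-z'+\tfrac12(xy'-x'y))^2\big)^{1/4}$ for $p=(x,y,z)$, $q=(x',y',z')$. $f:(X,d_X)\to(Y,d_Y)$ is $L$-bi-Lipschitz if $L^{-1}d_X(a,b)\le d_Y(f(a),f(b))\le Ld_X(a,b)$ for all $a,b$; $\mathrm{Lip}(X,Y)$ is the infimum of such $L$ over maps $X\to Y$. $\mathbb{R}^4$ has the Euclidean metric. *)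

(* Defs.v *)
From Stdlib Require Import Reals.
From Coquelicot Require Import Coquelicot.
Open Scope R_scope.

Definition pt := (R * R * R)%type.
Definition px (p : pt) : R := fst (fst p).
Definition py (p : pt) : R := snd (fst p).
Definition pz (p : pt) : R := snd p.
Definition pt0 : pt := (0, 0, 0).
Definition add3 (a b : pt) : pt := (px a + px b, py a + py b, pz a + pz b).
Definition scal3 (s : R) (a : pt) : pt := (s * px a, s * py a, s * pz a).

Definition pt4 := (R * R * R * R)%type.

Definition dE3 (p q : pt) : R :=
  sqrt ((px p - px q) ^ 2 + (py p - py q) ^ 2 + (pz p - pz q) ^ 2).
Definition dE4 (a b : pt4) : R :=
  match a, b with
  | (a1, a2, a3, a4), (b1, b2, b3, b4) =>
      sqrt ((a1 - b1) ^ 2 + (a2 - b2) ^ 2 + (a3 - b3) ^ 2 + (a4 - b4) ^ 2)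
  end.

Definition dK (p q : pt) : R :=
  sqrt (sqrt ((((px p - px q) ^ 2 + (py p - py q) ^ 2) ^ 2)
    + 16 * (pz p - pz q + / 2 * (px p * py q - px q * py p)) ^ 2)).

(* Horizontal frame X = d_x - y/2 d_z, Y = d_y + x/2 d_z at p *)
Definition Xf (p : pt) : pt := (1, 0, - py p / 2).
Definition Yf (p : pt) : pt := (0, 1, px p / 2).

Definition span2 (a b : pt) : pt -> Prop :=
  fun w => exists s t : R, w = add3 (scal3 s a) (scal3 t b).

Definition open3 (V : pt -> Prop) : Prop :=
  forall p, V p -> exists r, 0 < r /\ forall q, dE3 p q < r -> V q.
Definition open1 (W : R -> Prop) : Prop :=
  forall t, W t -> exists r, 0 < r /\ forall s, Rabs (s - t) < r -> W s.
Definition dE2 (u v u' v' : R) : R := sqrt ((u - u') ^ 2 + (v - v') ^ 2).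
Definition open2 (W : R -> R -> Prop) : Prop :=
  forall u v, W u v -> exists r, 0 < r /\
    forall u' v', dE2 u' v' u v < r -> W u' v'.

Definition has_deriv3 (f : R -> pt) (t : R) (d : pt) : Prop :=
  is_derive (fun s => px (f s)) t (px d) /\
  is_derive (fun s => py (f s)) t (py d) /\
  is_derive (fun s => pz (f s)) t (pz d).

Definition chart1 (gam : pt -> Prop) (V : pt -> Prop) (W : R -> Prop)
    (phi : R -> pt) (dphi : R -> pt) : Prop :=
  open3 V /\ open1 W /\
  (forall t, W t -> has_deriv3 phi t (dphi t)) /\
  (exists K, forall s t, W s -> W t -> dE3 (dphi s) (dphi t) <= K * Rabs (s - t)) /\
  (forall t, W t -> dphi t <> pt0) /\
  (forall t, W t -> gam (phi t) /\ V (phi t)) /\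
  (forall p, gam p -> V p -> exists t, W t /\ phi t = p) /\
  (forall s t, W s -> W t -> phi s = phi t -> s = t) /\
  (forall t, W t -> forall e, 0 < e -> exists d, 0 < d /\
     forall s, W s -> dE3 (phi s) (phi t) < d -> Rabs (s - t) < e).

Definition C11_manifold1 (gam : pt -> Prop) : Prop :=
  forall p, gam p -> exists V W phi dphi, V p /\ chart1 gam V W phi dphi.

Definition chart2 (M : pt -> Prop) (V : pt -> Prop) (W : R -> R -> Prop)
    (phi : R -> R -> pt) (du dv : R -> R -> pt) : Prop :=
  open3 V /\ open2 W /\
  (forall u v, W u v ->
     has_deriv3 (fun s => phi s v) u (du u v) /\
     has_deriv3 (fun s => phi u s) v (dv u v)) /\
  (exists K, forall u v u' v', W u v -> W u' v' ->
     dE3 (du u v) (du u' v') <= K * dE2 u v u' v' /\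
     dE3 (dv u v) (dv u' v') <= K * dE2 u v u' v') /\
  (forall u v, W u v -> forall a b,
     add3 (scal3 a (du u v)) (scal3 b (dv u v)) = pt0 -> a = 0 /\ b = 0) /\
  (forall u v, W u v -> M (phi u v) /\ V (phi u v)) /\
  (forall p, M p -> V p -> exists u v, W u v /\ phi u v = p) /\
  (forall u v u' v', W u v -> W u' v' -> phi u v = phi u' v' -> u = u' /\ v = v') /\
  (forall u v, W u v -> forall e, 0 < e -> exists d, 0 < d /\
     forall u' v', W u' v' -> dE3 (phi u' v') (phi u v) < d -> dE2 u' v' u v < e).

Definition C11_manifold2 (M : pt -> Prop) : Prop :=
  forall p, M p -> exists V W phi du dv, V p /\ chart2 M V W phi du dv.

(* x is characteristic: T_x M = H_x, where T_x M is the span of the partial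
   derivatives of any chart through x. *)
Definition characteristic (M : pt -> Prop) (x : pt) : Prop :=
  forall V W phi du dv u v, chart2 M V W phi du dv -> W u v -> phi u v = x ->
    forall w, span2 (du u v) (dv u v) w <-> span2 (Xf x) (Yf x) w.

Definition H_regular (M : pt -> Prop) (x : pt) : Prop := ~ characteristic M x.

Definition nbhd_in (S U : pt -> Prop) (x : pt) : Prop :=
  (forall p, U p -> S p) /\
  exists r, 0 < r /\ forall p, S p -> dE3 x p < r -> U p.

Definition biLip_on (U : pt -> Prop) (L : R) (f : pt -> pt4) : Prop :=
  forall a b, U a -> U b ->
    / L * dK a b <= dE4 (f a) (f b) /\ dE4 (f a) (f b) <= L * dK a b.

(* Lip((U,dK), R^4) <= L : the infimum of bi-Lipschitz constants is <= L *)
Definition Lip_le (U : pt -> Prop) (L : R) : Prop :=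
  forall L', L < L' -> exists f : pt -> pt4, biLip_on U L' f.

(* Main.v *)
Require Import Defs.
From Stdlib Require Import Reals Lra Lia ZArith List Psatz Classical ClassicalEpsilon.
From Coquelicot Require Import Coquelicot.
Import ListNotations.
Open Scope R_scope.

(** Near a point of [M] where the contact form [dz - (x dy - y dx) / 2] does not vanish on both
    tangent directions, the leaves of its kernel on [M] are horizontal curves, obtained as graphs
    [v = V u] of solutions of a scalar ODE in the parameter domain.  Label a point by
    [alpha = |w| u], where [w] is the projection of the leaf direction at the base point, and by
    [beta], a multiple of the height at which its leaf crosses [u = u0].  Moving along a leaf
    costs [|d alpha|] and sweeps out an area that is negligible against [d alpha ^ 2]; moving
    across leaves costs [|d beta| ^ (1/2)].  So on a small neighbourhood [dK] is comparable, with
    absolute constants, to [|d alpha| + |d beta| ^ (1/2)].  The factor [(R, |.| ^ (1/2))] embeds in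
    [R^3] as a self-similar snowflake curve of dimension two, which gives [R^4 = R x R^3].  A curve
    is treated by placing it in a surface that is not characteristic near the given point. *)

(** The difficulty is that the constant may not depend on the chart. The labels are therefore
    normalised by data at the base point: [sqrt w2] is the horizontal speed of the leaf, and [4 * b]
    turns a parameter gap across leaves into [4 * area], whose square enters the fourth power of
    [dK]. The chart then survives only in error terms, which a small neighbourhood absorbs. The
    number 40 comes from the snowflake bounds 128 and [/ 288] and the comparison factors 4 and 6
    alone. Lipschitz first derivatives make the slope of the leaves Lipschitz, so the gap between
    two leaves at any [u] nearly equals their gap at [u0], in ratio and not merely in size; hence a
    label read off at [u0] can stand for a distance measured elsewhere. The delicate errors are
    mixed. A step [delta] across the leaves also moves the horizontal projection by about [delta],
    and together with a step [h] along a leaf it creates an area of order [h * delta]. These need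
    not be small against [h ^ 2], but [delta ^ 2] and [h * delta] are small against [delta], which
    is already of the order of a squared distance. *)

(** * Geometric convergence and a fixed point principle *)

Lemma geometric_cauchy (a : nat -> R) (c : R) :
  (forall n, Rabs (a (S n) - a n) <= c * (/ 2) ^ n) ->
  exists l : R, is_lim_seq a l /\ forall n, Rabs (a n - l) <= 2 * c * (/ 2) ^ n.
Proof.
  intros H.
  assert (B : forall n k, Rabs (a (n + k)%nat - a n) <= 2 * c * (/ 2) ^ n * (1 - (/ 2) ^ k)).
  { intros n k. induction k as [|k IH].
    - rewrite Nat.add_0_r, Rminus_diag, Rabs_R0. simpl. lra.
    - rewrite Nat.add_succ_r.
      replace (a (S (n + k)) - a n)
        with ((a (S (n + k)) - a (n + k)%nat) + (a (n + k)%nat - a n)) by ring.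
      eapply Rle_trans; [apply Rabs_triang|].
      specialize (H (n + k)%nat). rewrite pow_add in H. simpl pow. nra. }
  assert (c0 : 0 <= c).
  { specialize (H 0%nat). generalize (Rabs_pos (a 1%nat - a 0%nat)). simpl in H. lra. }
  assert (B' : forall n k, Rabs (a (n + k)%nat - a n) <= 2 * c * (/ 2) ^ n).
  { intros n k. eapply Rle_trans; [apply B|].
    assert (0 <= (/2)^k) by (apply pow_le; lra). assert (0 <= (/2)^n) by (apply pow_le; lra).
    assert (0 <= c * (/2)^n) by (apply Rmult_le_pos; auto). nra. }
  assert (E : ex_finite_lim_seq a).
  { apply ex_lim_seq_cauchy_corr. intros eps.
    destruct (pow_lt_1_zero (/ 2)) with (y := eps / (4 * c + 1)) as [N HN].
    - rewrite Rabs_pos_eq; lra.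
    - apply Rdiv_lt_0_compat; [apply cond_pos | lra].
    - exists N. intros n m Hn Hm. specialize (HN N (Nat.le_refl _)).
      rewrite Rabs_pos_eq in HN by (apply pow_le; lra).
      apply Rmult_lt_compat_r with (r := 4 * c + 1) in HN; [|lra].
      unfold Rdiv in HN. rewrite Rmult_assoc, Rinv_l in HN by lra.
      assert (H1 := B' N (n - N)%nat). assert (H2 := B' N (m - N)%nat).
      replace (N + (n - N))%nat with n in H1 by lia.
      replace (N + (m - N))%nat with m in H2 by lia.
      replace (a n - a m) with ((a n - a N) - (a m - a N)) by ring.
      eapply Rle_lt_trans; [apply Rabs_triang|]. rewrite Rabs_Ropp.
      assert (0 <= (/2)^N) by (apply pow_le; lra). nra. }
  destruct E as [l Hl]. exists l. split; [exact Hl|]. intros n.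
  assert (L : is_lim_seq (fun k => Rabs (a (k + n)%nat - a n)) (Rabs (l - a n))).
  { apply (is_lim_seq_abs (fun k => a (k + n)%nat - a n) (l - a n)).
    apply is_lim_seq_minus'; [|apply is_lim_seq_const].
    apply (is_lim_seq_incr_n a n), Hl. }
  rewrite Rabs_minus_sym.
  apply (is_lim_seq_le (fun k => Rabs (a (k + n)%nat - a n)) (fun _ => 2 * c * (/ 2) ^ n)
    (Rabs (l - a n)) (2 * c * (/ 2) ^ n));
    [|exact L|apply is_lim_seq_const].
  intros k. rewrite Nat.add_comm. apply B'.
Qed.

Lemma le_of_le_add_pow (x c : R) : (forall n, x <= c * (/ 2) ^ n) -> x <= 0.
Proof.
  intros H. apply (is_lim_seq_le (fun _ => x) (fun n => c * (/ 2) ^ n) x 0); auto.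
  - apply is_lim_seq_const.
  - replace (Finite 0) with (Rbar_mult c 0) by (simpl; f_equal; ring).
    apply is_lim_seq_scal_l, is_lim_seq_geom. rewrite Rabs_pos_eq; lra.
Qed.

(** Banach's theorem for bounded real functions on a bare index type, used both for the snowflake
    and for differential equations. Invariants only have to survive pointwise limits, while the
    explicit rate of the iterates makes their convergence uniform. *)
Lemma contraction_fixed_point (I : Type) (P : (I -> R) -> Prop) (T : (I -> R) -> I -> R)
    (f0 : I -> R) (M : R) :
  P f0 ->
  (forall f i, P f -> Rabs (f i) <= M) ->
  (forall f, P f -> P (T f)) ->
  (forall f g c, P f -> P g -> (forall i, Rabs (f i - g i) <= c) ->
     forall i, Rabs (T f i - T g i) <= c / 2) ->
  (forall (s : nat -> I -> R) (f : I -> R), (forall n, P (s n)) ->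
     (forall i, is_lim_seq (fun n => s n i) (f i)) -> P f) ->
  exists f, P f /\ forall i, T f i = f i.
Proof.
  intros P0 HM HT Hc Hlim.
  set (s := fun n => Nat.iter n T f0).
  assert (Ps : forall n, P (s n)).
  { intros n. induction n; simpl; auto. }
  assert (D : forall n i, Rabs (s (S n) i - s n i) <= (2 * M) * (/ 2) ^ n).
  { intros n. induction n as [|n IH]; intros i.
    - simpl pow. generalize (HM _ i (Ps 1%nat)) (HM _ i (Ps 0%nat)). intros.
      eapply Rle_trans; [apply Rabs_triang|]. rewrite Rabs_Ropp. lra.
    - simpl pow. replace (2 * M * (/ 2 * (/ 2) ^ n)) with (2 * M * (/ 2) ^ n / 2) by (field).
      apply Hc; auto. }
  assert (E : forall i, exists l : R, is_lim_seq (fun n => s n i) l /\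
                   forall n, Rabs (s n i - l) <= 2 * (2 * M) * (/ 2) ^ n).
  { intros i. apply geometric_cauchy. intros n. apply D. }
  set (f := fun i => proj1_sig (constructive_indefinite_description _ (E i))).
  assert (Hf : forall i, is_lim_seq (fun n => s n i) (f i) /\
                   forall n, Rabs (s n i - f i) <= 2 * (2 * M) * (/ 2) ^ n).
  { intros i. exact (proj2_sig (constructive_indefinite_description _ (E i))). }
  assert (Pf : P f).
  { apply Hlim with s; auto. intros i. apply Hf. }
  exists f. split; auto. intros i.
  apply Rminus_diag_uniq, Rabs_eq_0, Rle_antisym; [|apply Rabs_pos].
  (* Both [T f] and [f] are within [2 * M * (/ 2) ^ n] of the iterate of index [S n]: the first by
     contraction, the second by the rate of convergence. *)
  apply le_of_le_add_pow with (4 * M). intros n.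
  assert (H1 := Hc _ _ _ Pf (Ps n) (fun i => ltac:(rewrite Rabs_minus_sym; apply (proj2 (Hf i)))) i).
  change (T (s n) i) with (s (S n) i) in H1.
  assert (H2 := proj2 (Hf i) (S n)). simpl pow in H2.
  replace (T f i - f i) with ((T f i - s (S n) i) + (s (S n) i - f i)) by ring.
  eapply Rle_trans; [apply Rabs_triang|]. lra.
Qed.

(** * A snowflake curve in [R^3] of dimension two *)

Inductive axis := Ax | Ay | Az.

Definition frame := (axis * bool)%type.

(** An isometry carrying the first unit vector to plus or minus the one along [fst f]: a
    transposition of coordinates, followed for [false] by the reflection through the origin. *)
Definition act (f : frame) (p : pt) : pt :=
  let q := match fst f with
           | Ax => p
           | Ay => (py p, px p, pz p)
           | Az => (pz p, py p, px p)
           end in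
  if snd f then q else scal3 (-1) q.

Definition zpt := (Z * Z * Z)%type.

Definition zadd (a b : zpt) : zpt :=
  (fst (fst a) + fst (fst b), snd (fst a) + snd (fst b), snd a + snd b)%Z.

(** The integer counterpart of [act]: all incidence questions about the walk become boolean
    computations on lattice points. *)
Definition zact (f : frame) (p : zpt) : zpt :=
  let '(a, b, c) := p in
  let '(a, b, c) := match fst f with
           | Ax => (a, b, c)
           | Ay => (b, a, c)
           | Az => (c, b, a)
           end in
  if snd f then (a, b, c) else (- a, - b, - c)%Z.

Definition ze1 : zpt := (1, 0, 0)%Z.

Definition toR (p : zpt) : pt := (IZR (fst (fst p)), IZR (snd (fst p)), IZR (snd p)).

(* A self-avoiding walk of 16 unit steps from [(0,0,0)] to [(4,0,0)] inside [[0,4] x [-1,1]^2]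
   which meets the slices [x = 0], [x = 3] and [x = 4] only on the axis: two copies placed at a
   corner then share nothing but the corner itself.  The first and last frames are the identity,
   so that refining a corner reproduces it. *)
Definition generator : list frame :=
  [(Ax, true); (Ay, true); (Az, true); (Ay, false); (Ay, false); (Az, false); (Az, false);
   (Ax, true); (Az, true); (Az, true); (Ay, true); (Ay, true); (Az, false); (Ay, false);
   (Ax, true); (Ax, true)].

Definition edge (j : nat) : frame := nth j generator (Ax, true).

Fixpoint vertex (j : nat) : zpt :=
  match j with
  | O => (0, 0, 0)%Z
  | S j => zadd (vertex j) (zact (edge j) ze1)
  end.

Definition e1 : pt := (1, 0, 0).

Definition sub3 (a b : pt) : pt := add3 a (scal3 (-1) b).

Definition nrm2 (p : pt) : R := px p ^ 2 + py p ^ 2 + pz p ^ 2.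

(* The radius [/ 3] solves [r = (1 + r) / 4]: a point within [/ 3] of an edge of the generator is,
   after rescaling by [/ 4], within [/ 3] of the unit segment.  As [/ 3 < / 2], tubes around disjoint
   lattice edges are disjoint. *)
Definition nearc (a b : Z) (x : R) : Prop :=
  IZR a - / 3 <= x <= IZR b + / 3 \/ IZR b - / 3 <= x <= IZR a + / 3.

Definition near (a b : zpt) (p : pt) : Prop :=
  nearc (fst (fst a)) (fst (fst b)) (px p) /\
  nearc (snd (fst a)) (snd (fst b)) (py p) /\
  nearc (snd a) (snd b) (pz p).

(** Disjoint integer intervals are at least 1 apart, hence still [/ 3] apart once each is enlarged
    by [/ 3]. This gap is the source of the bound [/ 9] for squared distances. *)
Definition sepc (a b c d : Z) : bool :=
  (Z.ltb (Z.max a b) (Z.min c d) || Z.ltb (Z.max c d) (Z.min a b))%bool.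

Definition sep (a b c d : zpt) : bool :=
  (sepc (fst (fst a)) (fst (fst b)) (fst (fst c)) (fst (fst d)) ||
   sepc (snd (fst a)) (snd (fst b)) (snd (fst c)) (snd (fst d)) ||
   sepc (snd a) (snd b) (snd c) (snd d))%bool.

Definition tube : pt -> Prop := near (0, 0, 0)%Z ze1.

Ltac pt_unfold :=
  cbv beta iota zeta delta [near tube act zact zadd toR add3 sub3 scal3 nrm2 px py pz e1 ze1 pt0
    fst snd] in *.

Lemma nearc_opp a b x : nearc a b x -> nearc (- a) (- b) (- x).
Proof. unfold nearc. rewrite !opp_IZR. lra. Qed.

Lemma nearc_shift k a b x : nearc a b x -> nearc (k + a) (k + b) (IZR k + x).
Proof. unfold nearc. rewrite !plus_IZR. lra. Qed.

Lemma nearc_sep a b c d x y :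
  sepc a b c d = true -> nearc a b x -> nearc c d y -> / 9 <= (x - y) ^ 2.
Proof.
  unfold sepc, nearc. intros H Hx Hy.
  assert (x - y <= - / 3 \/ / 3 <= x - y).
  { apply Bool.orb_prop in H. destruct H as [H|H]; apply Z.ltb_lt in H.
    - left. assert (H1 : (a + 1 <= c)%Z) by lia. assert (H2 : (a + 1 <= d)%Z) by lia.
      assert (H3 : (b + 1 <= c)%Z) by lia. assert (H4 : (b + 1 <= d)%Z) by lia.
      apply IZR_le in H1, H2, H3, H4. rewrite plus_IZR in *. lra.
    - right. assert (H1 : (c + 1 <= a)%Z) by lia. assert (H2 : (c + 1 <= b)%Z) by lia.
      assert (H3 : (d + 1 <= a)%Z) by lia. assert (H4 : (d + 1 <= b)%Z) by lia.
      apply IZR_le in H1, H2, H3, H4. rewrite plus_IZR in *. lra. }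
  nra.
Qed.

Lemma near_act f a b p : near a b p -> near (zact f a) (zact f b) (act f p).
Proof.
  destruct f as [[] []], a as [[a1 a2] a3], b as [[b1 b2] b3], p as [[x y] z];
    pt_unfold; intros (H1 & H2 & H3);
    repeat split; try assumption;
    match goal with |- nearc _ _ (-1 * ?x) => replace (-1 * x) with (- x) by ring end;
    apply nearc_opp; assumption.
Qed.

Lemma near_shift k a b p : near a b p -> near (zadd k a) (zadd k b) (add3 (toR k) p).
Proof.
  destruct k as [[k1 k2] k3], a as [[a1 a2] a3], b as [[b1 b2] b3], p as [[x y] z].
  pt_unfold. intros (H1 & H2 & H3). repeat split; apply nearc_shift; assumption.
Qed.

Lemma near_sep a b c d p q :
  sep a b c d = true -> near a b p -> near c d q -> / 9 <= nrm2 (sub3 p q).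
Proof.
  destruct a as [[a1 a2] a3], b as [[b1 b2] b3], c as [[c1 c2] c3], d as [[d1 d2] d3],
    p as [[x y] z], q as [[x' y'] z'].
  unfold sep. pt_unfold. intros H (H1 & H2 & H3) (H1' & H2' & H3').
  generalize (pow2_ge_0 (x - x')) (pow2_ge_0 (y - y')) (pow2_ge_0 (z - z')).
  replace (x + -1 * x') with (x - x') by ring. replace (y + -1 * y') with (y - y') by ring.
  replace (z + -1 * z') with (z - z') by ring. intros.
  rewrite !Bool.orb_true_iff in H. destruct H as [[H|H]|H].
  - generalize (nearc_sep _ _ _ _ _ _ H H1 H1'). lra.
  - generalize (nearc_sep _ _ _ _ _ _ H H2 H2'). lra.
  - generalize (nearc_sep _ _ _ _ _ _ H H3 H3'). lra.
Qed.

Lemma zact_0 f : zact f (0, 0, 0)%Z = (0, 0, 0)%Z.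
Proof. destruct f as [[] []]; reflexivity. Qed.

Lemma zadd_0_r k : zadd k (0, 0, 0)%Z = k.
Proof. destruct k as [[a b] c]. unfold zadd. simpl. rewrite !Z.add_0_r. reflexivity. Qed.

Lemma near_edge j p : tube p ->
  near (vertex j) (vertex (S j)) (add3 (toR (vertex j)) (act (edge j) p)).
Proof.
  intros H. apply (near_act (edge j)) in H. apply (near_shift (vertex j)) in H.
  rewrite zact_0, zadd_0_r in H. exact H.
Qed.

Definition forall_lt (n : nat) (P : nat -> bool) : bool := forallb P (seq 0 n).

Lemma forall_lt_spec n P : forall_lt n P = true -> forall i, (i < n)%nat -> P i = true.
Proof.
  unfold forall_lt. rewrite forallb_forall. intros H i Hi. apply H, in_seq. lia.
Qed.

(** Consecutive edges share a vertex, so the later edge is [S j], at least two steps after [i]. The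
    walk is short enough to evaluate every pair. *)
Lemma edges_separated i j : (i < j)%nat -> (S j < 16)%nat ->
  sep (vertex (S j)) (vertex (S (S j))) (vertex i) (vertex (S i)) = true.
Proof.
  intros Hi Hj.
  assert (H : forall_lt 16 (fun j => forall_lt j (fun i => (negb (Nat.ltb (S j) 16) ||
    sep (vertex (S j)) (vertex (S (S j))) (vertex i) (vertex (S i)))%bool)) = true)
    by (vm_compute; reflexivity).
  apply forall_lt_spec with (i := j) in H; [|lia].
  apply forall_lt_spec with (i := i) in H; [|lia].
  apply Bool.orb_prop in H. destruct H as [H|H]; auto.
  apply Nat.ltb_lt in Hj. rewrite Hj in H. discriminate.
Qed.

(** Enlarged four times, edge [k] is refined from the origin to [p] and edge [S k] from [p] onwards.
    Only the last subedge of the former and the first of the latter meet, at [p]; that pair is the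
    excluded one. *)
Lemma corner_separated k i j : (S k < 16)%nat -> (i < 16)%nat -> (j < 16)%nat ->
  ~ (i = 15 /\ j = 0)%nat ->
  let f := edge k in let f' := edge (S k) in
  let p := zact f (4, 0, 0)%Z in
  sep (zadd p (zact f' (vertex j))) (zadd p (zact f' (vertex (S j))))
    (zact f (vertex i)) (zact f (vertex (S i))) = true.
Proof.
  intros Hk Hi Hj Hij. cbv zeta.
  assert (H : forall_lt 15 (fun k => forall_lt 16 (fun i => forall_lt 16 (fun j =>
    (Nat.eqb i 15 && Nat.eqb j 0 ||
     sep (zadd (zact (edge k) (4, 0, 0)%Z) (zact (edge (S k)) (vertex j)))
       (zadd (zact (edge k) (4, 0, 0)%Z) (zact (edge (S k)) (vertex (S j))))
       (zact (edge k) (vertex i)) (zact (edge k) (vertex (S i))))%bool))) = true)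
    by (vm_compute; reflexivity).
  apply forall_lt_spec with (i := k) in H; [|lia].
  apply forall_lt_spec with (i := i) in H; [|lia].
  apply forall_lt_spec with (i := j) in H; [|lia].
  apply Bool.orb_prop in H. destruct H as [H|H]; auto.
  apply andb_prop in H. destruct H as [H1 H2].
  apply Nat.eqb_eq in H1, H2. destruct Hij; auto.
Qed.

Definition in_range (a : zpt) : bool :=
  let '(x, y, z) := a in
  (Z.leb 0 x && Z.leb x 4 && Z.leb (-1) y && Z.leb y 1 && Z.leb (-1) z && Z.leb z 1)%bool.

Lemma vertex_in_range j : (j <= 16)%nat -> in_range (vertex j) = true.
Proof.
  intros Hj.
  assert (H : forall_lt 17 (fun j => in_range (vertex j)) = true) by (vm_compute; reflexivity).
  apply forall_lt_spec with (i := j) in H; auto. lia.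
Qed.

Lemma tube_of_near a b p : in_range a = true -> in_range b = true -> near a b p ->
  tube (scal3 (/ 4) p).
Proof.
  destruct a as [[a1 a2] a3], b as [[b1 b2] b3], p as [[x y] z].
  unfold in_range. rewrite !Bool.andb_true_iff, !Z.leb_le.
  intros (((((K1 & K2) & K3) & K4) & K5) & K6) (((((B1 & B2) & B3) & B4) & B5) & B6) (H1 & H2 & H3).
  apply IZR_le in K1, K2, K3, K4, K5, K6, B1, B2, B3, B4, B5, B6.
  pt_unfold. unfold nearc in *. repeat split; left; lra.
Qed.

Definition piece (j : nat) (p : pt) : pt :=
  scal3 (/ 4) (add3 (toR (vertex j)) (act (edge j) p)).

Lemma tube_piece j p : (j < 16)%nat -> tube p -> tube (piece j p).
Proof.
  intros Hj Hp. apply (tube_of_near (vertex j) (vertex (S j))).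
  - apply vertex_in_range. lia.
  - apply vertex_in_range. lia.
  - apply near_edge, Hp.
Qed.

(** * The self-similar curve as a fixed point *)

Definition coord (c : axis) (p : pt) : R :=
  match c with Ax => px p | Ay => py p | Az => pz p end.

(** A curve is stored as one real function on [axis * R], the shape that [contraction_fixed_point]
    accepts. *)
Definition vec (f : axis * R -> R) (t : R) : pt := (f (Ax, t), f (Ay, t), f (Az, t)).

(** The leading digit in base 16; the cap at 15 assigns [t = 1] to the last piece. *)
Definition digit (t : R) : nat := Nat.min 15 (Z.to_nat (Int_part (16 * t))).

Definition clamp (a b t : R) : R := Rmax a (Rmin b t).

Lemma clamp_id a b t : a <= t <= b -> clamp a b t = t.
Proof. intros H. unfold clamp. rewrite Rmin_right, Rmax_right; lra. Qed.

Lemma clamp_range a b t : a <= b -> a <= clamp a b t <= b.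
Proof.
  intros H. unfold clamp. split; [apply Rmax_l|]. apply Rmax_lub; auto. apply Rmin_l.
Qed.

Lemma clamp_lipschitz a b s t : Rabs (clamp a b s - clamp a b t) <= Rabs (s - t).
Proof.
  unfold clamp, Rmax, Rmin.
  repeat destruct (Rle_dec _ _); unfold Rabs; repeat destruct (Rcase_abs _); lra.
Qed.

Lemma digit_lt t : (digit t < 16)%nat.
Proof. unfold digit. lia. Qed.

Lemma digit_spec j u : (j < 16)%nat -> 0 <= u < 1 -> digit ((INR j + u) / 16) = j.
Proof.
  intros Hj Hu. unfold digit. replace (16 * ((INR j + u) / 16)) with (u + IZR (Z.of_nat j)).
  2:{ rewrite <- INR_IZR_INZ. field. }
  rewrite <- (Int_part_spec (u + IZR (Z.of_nat j)) (Z.of_nat j)); [|lra].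
  rewrite Nat2Z.id. lia.
Qed.

Lemma digit_1 : digit 1 = 15%nat.
Proof.
  unfold digit. rewrite <- (Int_part_spec (16 * 1) 16); [reflexivity|lra].
Qed.

Definition curve_step (f : axis * R -> R) (i : axis * R) : R :=
  let t := snd i in
  coord (fst i) (piece (digit t) (vec f (clamp 0 1 (16 * t - INR (digit t))))).

Lemma vec_curve_step f t :
  vec (curve_step f) t = piece (digit t) (vec f (clamp 0 1 (16 * t - INR (digit t)))).
Proof.
  unfold vec at 1, curve_step. cbn [fst snd coord].
  destruct (piece _ _) as [[a b] c]. reflexivity.
Qed.

Lemma tube_iff p : tube p <->
  (- / 3 <= px p <= 4 / 3) /\ (- / 3 <= py p <= / 3) /\ (- / 3 <= pz p <= / 3).
Proof. destruct p as [[x y] z]. pt_unfold. unfold nearc. lra. Qed.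

Lemma is_lim_seq_bounds u l a b :
  (forall n : nat, a <= u n <= b) -> is_lim_seq u (Finite l) -> a <= l <= b.
Proof.
  intros H L. split.
  - apply (is_lim_seq_le (fun _ => a) u a l); auto. intros; apply H. apply is_lim_seq_const.
  - apply (is_lim_seq_le u (fun _ => b) l b); auto. intros; apply H. apply is_lim_seq_const.
Qed.

(** A frame only permutes coordinates up to sign, so the true ratio in the supremum norm is [/ 4];
    the weaker [/ 2] is what the fixed point principle asks for. *)
Lemma piece_contracts c j p q a :
  (forall c, Rabs (coord c p - coord c q) <= a) ->
  Rabs (coord c (piece j p) - coord c (piece j q)) <= a / 2.
Proof.
  intros H. generalize (H Ax) (H Ay) (H Az). simpl.
  unfold piece. destruct (toR (vertex j)) as [[v1 v2] v3].
  destruct p as [[x y] z], q as [[x' y'] z'].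
  destruct (edge j) as [[] []], c; simpl coord; pt_unfold; intros H1 H2 H3;
  apply Rabs_le_between in H1, H2, H3; apply Rabs_le_between; lra.
Qed.

(** The invariant fixes the endpoints at the origin and [e1], which makes consecutive pieces agree
    at their common vertex, and confines the curve to the tube, which gives the bound 2 here and the
    separation of pieces later. *)
Lemma snowflake_exists : exists g : R -> pt,
  (forall t, tube (g t)) /\
  forall j u, (j < 16)%nat -> 0 <= u <= 1 -> g ((INR j + u) / 16) = piece j (g u).
Proof.
  destruct (contraction_fixed_point (axis * R)
    (fun f => vec f 0 = pt0 /\ vec f 1 = e1 /\ forall t, tube (vec f t)) curve_step
    (fun i => match fst i with Ax => clamp 0 1 (snd i) | _ => 0 end) 2)
    as (f & (F0 & F1 & FT) & FE).
  - unfold vec. simpl. rewrite !clamp_id by lra. split; [|split]; try reflexivity.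
    intros t. apply tube_iff. unfold px, py, pz. simpl. generalize (clamp_range 0 1 t Rle_0_1). lra.
  - intros f [c t] (_ & _ & H). specialize (H t). rewrite tube_iff in H.
    unfold vec, px, py, pz in H. simpl in H. apply Rabs_le_between. destruct c; lra.
  - intros f (F0 & F1 & FT). split; [|split].
    + rewrite vec_curve_step. replace (digit 0) with 0%nat.
      * simpl INR. rewrite clamp_id by lra. replace (16 * 0 - 0) with 0 by ring. rewrite F0.
        unfold piece. change (edge 0) with (Ax, true). simpl. pt_unfold.
        (apply f_equal2; [apply f_equal2|]); ring.
      * symmetry. replace 0 with ((INR 0 + 0) / 16) by (simpl; field). apply digit_spec; [lia|lra].
    + rewrite vec_curve_step, digit_1. replace (16 * 1 - INR 15) with 1 by (simpl; ring).
      rewrite clamp_id, F1 by lra. unfold piece. change (vertex 15) with (3, 0, 0)%Z.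
      change (edge 15) with (Ax, true).
      pt_unfold. (apply f_equal2; [apply f_equal2|]); field.
    + intros t. rewrite vec_curve_step. apply tube_piece; auto using digit_lt.
  - intros f g c _ _ H [a t]. unfold curve_step. simpl fst. simpl snd.
    apply piece_contracts. intros []; simpl; unfold px, py, pz; simpl; apply H.
  - intros s f Hs L. split; [|split].
    + assert (E : forall c, f (c, 0) = 0).
      { intros c. assert (0 <= f (c, 0) <= 0); [|lra].
        apply is_lim_seq_bounds with (fun n => s n (c, 0)); auto.
        intros n. destruct (Hs n) as (H & _). injection H. intros. destruct c; lra. }
      unfold vec. rewrite !E. reflexivity.
    + assert (E : forall c, f (c, 1) = coord c e1).
      { intros c. assert (coord c e1 <= f (c, 1) <= coord c e1); [|lra].
        apply is_lim_seq_bounds with (fun n => s n (c, 1)); auto.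
        intros n. destruct (Hs n) as (_ & H & _). injection H. intros.
        destruct c; simpl; unfold e1, px, py, pz; simpl; lra. }
      unfold vec. rewrite !E. reflexivity.
    + intros t. apply tube_iff. unfold vec, px, py, pz. simpl.
      split; [|split]; (eapply is_lim_seq_bounds; [|apply L]);
      intros n; destruct (Hs n) as (_ & _ & H); specialize (H t); rewrite tube_iff in H; apply H.
  - exists (vec f). split; auto.
    assert (E : forall t, vec f t = piece (digit t) (vec f (clamp 0 1 (16 * t - INR (digit t))))).
    { intros t. rewrite <- vec_curve_step. unfold vec. rewrite !FE. reflexivity. }
    assert (E' : forall j u, (j < 16)%nat -> 0 <= u < 1 ->
                   vec f ((INR j + u) / 16) = piece j (vec f u)).
    { intros j u Hj Hu. rewrite E, digit_spec by assumption.
      replace (16 * ((INR j + u) / 16) - INR j) with u by field. rewrite clamp_id by lra. reflexivity. }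
    (* At [u = 1] with [j < 15] the digit already selects the next piece, so the equation has to be
       recovered from the endpoint values: the end of piece [j] is the start of piece [S j]. *)
    intros j u Hj Hu. destruct (Req_dec u 1) as [->|Hu1]; [|apply E'; auto; lra].
    destruct (Nat.eq_dec j 15) as [->|Hj'].
    + replace ((INR 15 + 1) / 16) with 1 by (simpl; field). rewrite F1.
      unfold piece. change (vertex 15) with (3, 0, 0)%Z.
      change (edge 15) with (Ax, true). pt_unfold. (apply f_equal2; [apply f_equal2|]); field.
    + replace ((INR j + 1) / 16) with ((INR (S j) + 0) / 16) by (rewrite S_INR; field).
      rewrite E' by (lra || lia). rewrite F0, F1. unfold piece. simpl vertex.
      destruct (vertex j) as [[a b] c]. destruct (edge j) as [[] []], (edge (S j)) as [[] []];
      pt_unfold; simpl; rewrite ?plus_IZR; (apply f_equal2; [apply f_equal2|]); field.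
Qed.

(** * Two-sided bounds of exponent one half for the curve *)

Lemma nrm2_nonneg p : 0 <= nrm2 p.
Proof.
  unfold nrm2. generalize (pow2_ge_0 (px p)) (pow2_ge_0 (py p)) (pow2_ge_0 (pz p)). lra.
Qed.

Lemma nrm2_act f p q : nrm2 (sub3 (act f p) (act f q)) = nrm2 (sub3 p q).
Proof.
  destruct f as [[] []], p as [[x y] z], q as [[x' y'] z']; pt_unfold; ring.
Qed.

(** The squared ratio [/ 16] equals the length of a parameter interval. Squared distance over
    parameter distance is thus invariant under refinement, which is dimension two. *)
Lemma nrm2_piece j p q : nrm2 (sub3 (piece j p) (piece j q)) = nrm2 (sub3 p q) / 16.
Proof.
  rewrite <- (nrm2_act (edge j) p q). unfold piece.
  destruct (toR (vertex j)) as [[a b] c], (act (edge j) p) as [[x y] z],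
    (act (edge j) q) as [[x' y'] z']; pt_unfold; field.
Qed.

Lemma nrm2_triangle p q r : nrm2 (sub3 p r) <= 2 * (nrm2 (sub3 p q) + nrm2 (sub3 q r)).
Proof.
  destruct p as [[x y] z], q as [[x' y'] z'], r as [[x'' y''] z'']. pt_unfold.
  generalize (pow2_ge_0 (x - 2 * x' + x'')) (pow2_ge_0 (y - 2 * y' + y''))
    (pow2_ge_0 (z - 2 * z' + z'')). nra.
Qed.

Lemma nrm2_sym p q : nrm2 (sub3 p q) = nrm2 (sub3 q p).
Proof. destruct p as [[x y] z], q as [[x' y'] z']. pt_unfold. ring. Qed.

Lemma unit_split t : 0 <= t <= 1 ->
  exists j u, (j < 16)%nat /\ 0 <= u <= 1 /\ t = (INR j + u) / 16.
Proof.
  intros Ht. destruct (Req_dec t 1) as [->|H1].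
  - exists 15%nat, 1. split; [lia|]. simpl. split; lra.
  - destruct (base_Int_part (16 * t)) as [B1 B2].
    assert (L : (0 <= Int_part (16 * t))%Z).
    { assert (-1 < Int_part (16 * t))%Z; [|lia]. apply lt_IZR. lra. }
    assert (U : (Int_part (16 * t) < 16)%Z) by (apply lt_IZR; lra).
    exists (Z.to_nat (Int_part (16 * t))), (16 * t - IZR (Int_part (16 * t))).
    split; [lia|]. rewrite INR_IZR_INZ, Z2Nat.id by lia. split; [lra|]. field.
Qed.

Definition flake : R -> pt := proj1_sig (constructive_indefinite_description _ snowflake_exists).

Lemma flake_tube t : tube (flake t).
Proof. apply (proj2_sig (constructive_indefinite_description _ snowflake_exists)). Qed.

Lemma flake_piece j u : (j < 16)%nat -> 0 <= u <= 1 ->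
  flake ((INR j + u) / 16) = piece j (flake u).
Proof. apply (proj2_sig (constructive_indefinite_description _ snowflake_exists)). Qed.

Lemma flake_diameter s t : nrm2 (sub3 (flake s) (flake t)) <= 4.
Proof.
  generalize (flake_tube s) (flake_tube t). rewrite !tube_iff.
  destruct (flake s) as [[x y] z], (flake t) as [[x' y'] z'].
  pt_unfold. intros (X & Y & Z) (X' & Y' & Z').
  assert (A1 : (x + -1 * x') ^ 2 <= 25 / 9) by nra.
  assert (A2 : (y + -1 * y') ^ 2 <= 4 / 9) by nra.
  assert (A3 : (z + -1 * z') ^ 2 <= 4 / 9) by nra. lra.
Qed.

(** The extra term lets the induction start from the diameter bound alone and disappears as [n]
    grows. For [t <= / 16] both points lie in piece 0 and rescaling applies; otherwise [64 * t]
    already exceeds the squared diameter bound 4. *)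
Lemma flake_holder_at_0_approx n : forall t, 0 <= t <= 1 ->
  nrm2 (sub3 (flake t) (flake 0)) <= 64 * t + 4 * (/ 2) ^ n.
Proof.
  induction n as [|n IH]; intros t Ht.
  - simpl. generalize (flake_diameter t 0). lra.
  - assert (0 <= (/ 2) ^ n) by (apply pow_le; lra). simpl pow.
    destruct (Rle_dec t (/ 16)) as [H'|H'].
    + specialize (IH (16 * t) ltac:(lra)).
      replace t with ((INR 0 + 16 * t) / 16) at 1 by (simpl; field).
      replace 0 with ((INR 0 + 0) / 16) at 1 by (simpl; field).
      rewrite !flake_piece, nrm2_piece by (lra || lia). lra.
    + generalize (flake_diameter t 0). lra.
Qed.

Lemma flake_holder_at_1_approx n : forall t, 0 <= t <= 1 ->
  nrm2 (sub3 (flake t) (flake 1)) <= 64 * (1 - t) + 4 * (/ 2) ^ n.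
Proof.
  induction n as [|n IH]; intros t Ht.
  - simpl. generalize (flake_diameter t 1). lra.
  - assert (0 <= (/ 2) ^ n) by (apply pow_le; lra). simpl pow.
    destruct (Rle_dec (15 / 16) t) as [H'|H'].
    + specialize (IH (16 * t - 15) ltac:(lra)).
      replace t with ((INR 15 + (16 * t - 15)) / 16) at 1 by (simpl; field).
      replace 1 with ((INR 15 + 1) / 16) at 1 by (simpl; field).
      rewrite !flake_piece, nrm2_piece by (lra || lia). lra.
    + generalize (flake_diameter t 1). lra.
Qed.

Lemma le_of_approx x y c : (forall n, x <= y + c * (/ 2) ^ n) -> x <= y.
Proof.
  intros H. assert (x - y <= 0); [|lra]. apply le_of_le_add_pow with c. intros n.
  specialize (H n). lra.
Qed.

Lemma flake_holder_at_0 t : 0 <= t <= 1 -> nrm2 (sub3 (flake t) (flake 0)) <= 64 * t.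
Proof.
  intros Ht. apply le_of_approx with 4. intros n. apply flake_holder_at_0_approx, Ht.
Qed.

Lemma flake_holder_at_1 t : 0 <= t <= 1 -> nrm2 (sub3 (flake t) (flake 1)) <= 64 * (1 - t).
Proof.
  intros Ht. apply le_of_approx with 4. intros n. apply flake_holder_at_1_approx, Ht.
Qed.

Lemma digits_far i j u v : 0 <= u <= 1 -> 0 <= v <= 1 -> (S i < j)%nat ->
  / 16 <= (INR j + v) / 16 - (INR i + u) / 16.
Proof.
  intros Hu Hv Hij. apply le_INR in Hij. rewrite !S_INR in Hij. lra.
Qed.

Lemma pieces_meet i : (S i < 16)%nat -> piece (S i) (flake 0) = piece i (flake 1).
Proof.
  intros Hi. rewrite <- !flake_piece by (lra || lia). f_equal. rewrite S_INR. field.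
Qed.

Lemma piece_index_lt i j u v : 0 <= u <= 1 -> 0 <= v <= 1 -> i <> j ->
  (INR i + u) / 16 < (INR j + v) / 16 -> (i < j)%nat.
Proof.
  intros Hu Hv Hij H. destruct (Nat.lt_ge_cases i j) as [|G]; auto.
  assert (J : (S j <= i)%nat) by lia. apply le_INR in J. rewrite S_INR in J. lra.
Qed.

(** Points of one piece are rescaled, points of distant pieces are at parameter distance at least
    [/ 16], and points of adjacent pieces are compared through the common corner. There the squared
    triangle inequality doubles 64 to 128. *)
Lemma flake_upper_approx n : forall s t, 0 <= s < t -> t <= 1 ->
  nrm2 (sub3 (flake s) (flake t)) <= 128 * (t - s) + 4 * (/ 2) ^ n.
Proof.
  induction n as [|n IH]; intros s t Hs Ht.
  - simpl. generalize (flake_diameter s t). lra.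
  - assert (0 <= (/ 2) ^ n) by (apply pow_le; lra). simpl pow.
    destruct (unit_split s) as (i & u & Hi & Hu & Es); [lra|].
    destruct (unit_split t) as (j & v & Hj & Hv & Et); [lra|].
    destruct (Nat.eq_dec i j) as [<-|Hij].
    + specialize (IH u v ltac:(lra) ltac:(lra)).
      rewrite Es, Et, !flake_piece, nrm2_piece by assumption. lra.
    + assert (Hlt : (i < j)%nat) by (apply (piece_index_lt i j u v); auto; lra).
      destruct (Nat.eq_dec j (S i)) as [->|Hij'].
      * rewrite Es, Et, !flake_piece by assumption.
        eapply Rle_trans; [apply nrm2_triangle with (q := piece i (flake 1))|].
        rewrite <- pieces_meet at 2 by assumption. rewrite !nrm2_piece, (nrm2_sym (flake 0)).
        generalize (flake_holder_at_0 v Hv) (flake_holder_at_1 u Hu). rewrite S_INR. lra.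
      * assert (F := digits_far i j u v Hu Hv ltac:(lia)).
        generalize (flake_diameter s t). lra.
Qed.

(* The two adjacent pieces at a corner are rescaled copies of the same corner, so only pairs of
   subpieces that do not touch have to be compared directly. *)
Lemma flake_corner_approx k n : (S k < 16)%nat -> forall u v, 0 <= u <= 1 -> 0 <= v <= 1 ->
  (1 - u) + v <= 288 * nrm2 (sub3 (add3 (toR (zact (edge k) ze1)) (act (edge (S k)) (flake v)))
                                  (act (edge k) (flake u))) + 2 * (/ 2) ^ n.
Proof.
  intros Hk. induction n as [|n IH]; intros u v Hu Hv.
  - generalize (nrm2_nonneg (sub3 (add3 (toR (zact (edge k) ze1)) (act (edge (S k)) (flake v)))
                                  (act (edge k) (flake u)))). simpl. lra.
  - assert (0 <= (/ 2) ^ n) by (apply pow_le; lra). simpl pow.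
    destruct (unit_split u) as (i & u' & Hi & Hu' & Eu); [lra|].
    destruct (unit_split v) as (j & v' & Hj & Hv' & Ev); [lra|].
    rewrite Eu, Ev, !flake_piece by assumption.
    destruct (classic (i = 15 /\ j = 0)%nat) as [[-> ->]|Hij].
    + specialize (IH u' v' Hu' Hv').
      match goal with |- _ <= 288 * ?a + _ => match type of IH with _ <= 288 * ?b + _ =>
        assert (E : a = b / 16) end end.
      { unfold piece. change (vertex 15) with (3, 0, 0)%Z. change (edge 15) with (Ax, true).
        change (edge 0) with (Ax, true). change (vertex 0) with (0, 0, 0)%Z.
        destruct (edge k) as [[] []], (edge (S k)) as [[] []], (flake u') as [[a b] c],
          (flake v') as [[a' b'] c']; pt_unfold; simpl; field. }
      rewrite E. simpl INR. lra.
    (* The squared gap is at least [/ 9] before scaling by [/ 4], hence [/ 144] after it, while the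
       left side is at most 2: this fixes the constant 288. *)
    + assert (Sp := corner_separated k i j Hk Hi Hj Hij). cbv zeta in Sp.
      assert (Nu := near_act (edge k) _ _ _ (near_edge i _ (flake_tube u'))).
      assert (Nv := near_act (edge (S k)) _ _ _ (near_edge j _ (flake_tube v'))).
      apply (near_shift (zact (edge k) (4, 0, 0)%Z)) in Nv.
      assert (G := near_sep _ _ _ _ _ _ Sp Nv Nu).
      match goal with |- _ <= 288 * ?a + _ => match type of G with _ <= ?b =>
        assert (E : a = b / 16) end end.
      { unfold piece.
        destruct (add3 (toR (vertex i)) (act (edge i) (flake u'))) as [[a b] c],
          (add3 (toR (vertex j)) (act (edge j) (flake v'))) as [[a' b'] c'],
          (edge k) as [[] []], (edge (S k)) as [[] []]; pt_unfold; simpl; field. }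
      rewrite E. lra.
Qed.

(** Rescaling goes on until [s] and [t] fall into different pieces. Tubes around non-adjacent edges
    are a definite distance apart; adjacent pieces are the corner case. *)
Lemma flake_lower_approx n : forall s t, 0 <= s < t -> t <= 1 ->
  t - s <= 288 * nrm2 (sub3 (flake t) (flake s)) + (/ 2) ^ n.
Proof.
  induction n as [|n IH]; intros s t Hs Ht.
  - generalize (nrm2_nonneg (sub3 (flake t) (flake s))). simpl. lra.
  - assert (P : 0 <= (/ 2) ^ n) by (apply pow_le; lra). simpl pow.
    destruct (unit_split s) as (i & u & Hi & Hu & Es); [lra|].
    destruct (unit_split t) as (j & v & Hj & Hv & Et); [lra|].
    destruct (Nat.eq_dec i j) as [<-|Hij].
    + specialize (IH u v ltac:(lra) ltac:(lra)).
      rewrite Es, Et, !flake_piece, nrm2_piece by assumption. lra.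
    + assert (Hlt : (i < j)%nat) by (apply (piece_index_lt i j u v); auto; lra).
      rewrite Es, Et, !flake_piece by assumption.
      destruct (Nat.eq_dec j (S i)) as [->|Hij'].
      * assert (C := flake_corner_approx i n Hj u v Hu Hv).
        match goal with |- _ <= 288 * ?a + _ => match type of C with _ <= 288 * ?b + _ =>
          assert (E : a = b / 16) end end.
        { unfold piece. cbn [vertex].
          destruct (vertex i) as [[p q] r], (act (edge (S i)) (flake v)) as [[a b] c],
            (act (edge i) (flake u)) as [[a' b'] c'], (zact (edge i) ze1) as [[a'' b''] c''];
          pt_unfold; rewrite !plus_IZR; field. }
        rewrite E, S_INR. lra.
      * destruct j as [|j]; [lia|].
        assert (Sp := edges_separated i j ltac:(lia) Hj).
        assert (Nu := near_edge i _ (flake_tube u)).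
        assert (Nv := near_edge (S j) _ (flake_tube v)).
        assert (G := near_sep _ _ _ _ _ _ Sp Nv Nu).
        match goal with |- _ <= 288 * ?a + _ => match type of G with _ <= ?b =>
          assert (E : a = b / 16) end end.
        { unfold piece.
          destruct (add3 (toR (vertex i)) (act (edge i) (flake u))) as [[a b] c],
            (add3 (toR (vertex (S j))) (act (edge (S j)) (flake v))) as [[a' b'] c'].
          pt_unfold; field. }
        rewrite E. lra.
Qed.

Lemma flake_bilipschitz s t : 0 <= s <= 1 -> 0 <= t <= 1 ->
  Rabs (s - t) / 288 <= nrm2 (sub3 (flake s) (flake t)) <= 128 * Rabs (s - t).
Proof.
  assert (K : forall s t, 0 <= s < t -> t <= 1 ->
    (t - s) / 288 <= nrm2 (sub3 (flake s) (flake t)) <= 128 * (t - s)).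
  { intros a b Ha Hb. split.
    - assert (b - a <= 288 * nrm2 (sub3 (flake b) (flake a))).
      { apply le_of_approx with 1. intros n. rewrite Rmult_1_l. apply flake_lower_approx; auto. }
      rewrite nrm2_sym. lra.
    - apply le_of_approx with 4. intros n. apply flake_upper_approx; auto. }
  intros Hs Ht. destruct (Rtotal_order s t) as [H|[->|H]].
  - rewrite Rabs_minus_sym, Rabs_pos_eq by lra. apply K; lra.
  - rewrite Rminus_diag, Rabs_R0. replace (nrm2 _) with 0; [lra|].
    destruct (flake t) as [[x y] z]. pt_unfold. ring.
  - rewrite Rabs_pos_eq by lra. rewrite nrm2_sym. apply K; lra.
Qed.

(** * From adapted coordinates to bi-Lipschitz embeddings *)

(** The vertical coordinate of the product of the inverse of [q] with [p] in the Heisenberg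
    group. *)
Definition area (p q : pt) : R := pz p - pz q + / 2 * (px p * py q - px q * py p).

Definition hdist2 (p q : pt) : R := (px p - px q) ^ 2 + (py p - py q) ^ 2.

Lemma dK_pow4 p q : 0 <= dK p q /\ (dK p q ^ 2) ^ 2 = hdist2 p q ^ 2 + 16 * area p q ^ 2.
Proof.
  unfold dK. split; [apply sqrt_pos|].
  rewrite pow2_sqrt by apply sqrt_pos. rewrite pow2_sqrt; [reflexivity|].
  generalize (pow2_ge_0 (hdist2 p q)) (pow2_ge_0 (area p q)). unfold hdist2, area. lra.
Qed.

Lemma le_of_pow2_le a b : 0 <= b -> a ^ 2 <= b ^ 2 -> a <= b.
Proof. intros Hb H. destruct (Rle_dec a b); auto. nra. Qed.

(** [da] models the horizontal displacement and [db] models [4 * area]. Each slack is a fraction of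
    the whole sum [da ^ 2 + Rabs db], since moving across leaves disturbs the horizontal part and
    moving along them the vertical part. *)
Definition adapted (p q : pt) (da db : R) : Prop :=
  hdist2 p q <= 2 * da ^ 2 + (da ^ 2 + Rabs db) / 50 /\
  da ^ 2 <= 2 * hdist2 p q + (da ^ 2 + Rabs db) / 50 /\
  Rabs (4 * area p q - db) <= (da ^ 2 + Rabs db) / 10.

Lemma adapted_dK p q da db : adapted p q da db ->
  da ^ 2 + Rabs db <= 6 * dK p q ^ 2 /\ dK p q ^ 2 <= 4 * (da ^ 2 + Rabs db).
Proof.
  intros (H1 & H2 & H3). destruct (dK_pow4 p q) as [Q0 Q].
  generalize (pow2_ge_0 (px p - px q)) (pow2_ge_0 (py p - py q)). intros X Y.
  assert (P0 : 0 <= hdist2 p q) by (unfold hdist2; lra).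
  replace (16 * area p q ^ 2) with (Rabs (4 * area p q) ^ 2) in Q
    by (rewrite pow2_abs; ring).
  assert (T0 := Rabs_pos (4 * area p q)). assert (B0 := Rabs_pos db).
  assert (T1 : Rabs (4 * area p q) <= Rabs db + (da ^ 2 + Rabs db) / 10).
  { replace (4 * area p q) with ((4 * area p q - db) + db) by ring.
    eapply Rle_trans; [apply Rabs_triang|]. lra. }
  assert (T2 : Rabs db <= Rabs (4 * area p q) + (da ^ 2 + Rabs db) / 10).
  { replace db with (4 * area p q - (4 * area p q - db)) at 1 by ring.
    eapply Rle_trans; [apply Rabs_triang|]. rewrite Rabs_Ropp. lra. }
  assert (A0 := pow2_ge_0 da).
  revert Q T0 T1 T2 H1 H2 P0 A0 B0. clear H3 X Y.
  generalize (Rabs (4 * area p q)) (Rabs db) (hdist2 p q) (da ^ 2).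
  intros T B P A Q T0 T1 T2 H1 H2 P0 A0 B0.
  assert (D0 := pow2_ge_0 (dK p q)). split.
  - apply le_of_pow2_le; [lra|]. rewrite Rpow_mult_distr, Q.
    apply Rle_trans with ((3 * P + 2 * T) ^ 2); [apply pow_incr; lra|].
    generalize (pow2_ge_0 (P - T)). nra.
  - apply le_of_pow2_le; [lra|]. rewrite Q.
    apply Rle_trans with ((P + T) ^ 2); [nra|apply pow_incr; lra].
Qed.

Lemma Lip_le_of_adapted_coordinates (I : Type) (D : I -> Prop) (phi : I -> pt)
    (alpha beta : I -> R) :
  (forall i, D i -> Rabs (beta i) <= / 2) ->
  (forall i j, D i -> D j -> adapted (phi i) (phi j) (alpha i - alpha j) (beta i - beta j)) ->
  Lip_le (fun p => exists i, D i /\ phi i = p) 40.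
Proof.
  intros Hb HA L' HL'.
  destruct (classic (inhabited I)) as [[i0]|N].
  2:{ exists (fun _ => (0, 0, 0, 0)). intros a b (i & _). destruct N. constructor. exact i. }
  (* Any choice of parameter will do, because the estimates hold for all pairs of indices in [D]. *)
  set (par := fun p => epsilon (inhabits i0) (fun i => D i /\ phi i = p)).
  exists (fun p => (alpha (par p), px (flake (/ 2 + beta (par p))), py (flake (/ 2 + beta (par p))),
                    pz (flake (/ 2 + beta (par p))))).
  intros a b Ha Hb'.
  assert (Pa : D (par a) /\ phi (par a) = a) by (apply epsilon_spec, Ha).
  assert (Pb : D (par b) /\ phi (par b) = b) by (apply epsilon_spec, Hb').
  destruct Pa as [Da Ea], Pb as [Db Eb].
  generalize (HA _ _ Da Db) (Hb _ Da) (Hb _ Db). rewrite Ea, Eb.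
  generalize (alpha (par a)) (alpha (par b)) (beta (par a)) (beta (par b)).
  intros x x' y y' Had Hy Hy'.
  apply Rabs_le_between in Hy, Hy'.
  destruct (flake_bilipschitz (/ 2 + y) (/ 2 + y')) as [F1 F2]; try lra.
  replace (/ 2 + y - (/ 2 + y')) with (y - y') in F1, F2 by ring.
  apply adapted_dK in Had. destruct Had as [K1 K2].
  assert (K0 : 0 <= dK a b) by apply dK_pow4.
  unfold dE4. set (X := (x - x') ^ 2 + _ + _ + _).
  assert (EX : X = (x - x') ^ 2 + nrm2 (sub3 (flake (/ 2 + y)) (flake (/ 2 + y')))).
  { unfold X. destruct (flake (/ 2 + y)) as [[f1 f2] f3], (flake (/ 2 + y')) as [[f1' f2'] f3'].
    pt_unfold. ring. }
  assert (B0 := Rabs_pos (y - y')). assert (A0 := pow2_ge_0 (x - x')).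
  assert (X0 : 0 <= X) by (rewrite EX; lra).
  assert (S0 := sqrt_pos X). assert (S1 := pow2_sqrt X X0).
  (* With [S] for the sum of [(x - x') ^ 2] and [Rabs (y - y')], [X] lies between [S / 288] and
     [128 * S]. The factors 4 and 6 of [adapted_dK] then give ratios of squares at most 1152 and
     768, both below 1600, the square of 40. *)
  assert (I1 : dK a b <= 40 * sqrt X).
  { apply le_of_pow2_le; [lra|]. rewrite Rpow_mult_distr, S1, EX. lra. }
  assert (I2 : sqrt X <= 40 * dK a b).
  { apply le_of_pow2_le; [lra|]. rewrite Rpow_mult_distr, S1, EX. lra. }
  split; [|nra].
  apply Rmult_le_reg_l with L'; [lra|]. rewrite <- Rmult_assoc, Rinv_r by lra. nra.
Qed.

(** * Scalar ordinary differential equations *)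

Lemma mvt_bound (f df : R -> R) (a b c M : R) :
  (forall s, Rmin a b <= s <= Rmax a b -> is_derive f s (df s) /\ Rabs (df s - c) <= M) ->
  Rabs (f b - f a - c * (b - a)) <= M * Rabs (b - a).
Proof.
  intros H. destruct (MVT_gen f a b df) as (s & Hs & E).
  - intros x Hx. apply H. lra.
  - intros x Hx. apply derivable_continuous_pt. exists (df x).
    apply is_derive_Reals, H, Hx.
  - rewrite E. replace (df s * (b - a) - c * (b - a)) with ((df s - c) * (b - a)) by ring.
    rewrite Rabs_mult. apply Rmult_le_compat_r; [apply Rabs_pos|]. apply H, Hs.
Qed.

Lemma mvt_bound0 (f df : R -> R) (a b M : R) :
  (forall s, Rmin a b <= s <= Rmax a b -> is_derive f s (df s) /\ Rabs (df s) <= M) ->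
  Rabs (f b - f a) <= M * Rabs (b - a).
Proof.
  intros H. replace (f b - f a) with (f b - f a - 0 * (b - a)) by ring.
  apply mvt_bound with df. intros s Hs. rewrite Rminus_0_r. auto.
Qed.

Lemma lipschitz_continuous (f : R -> R) (K : R) :
  (forall s t, Rabs (f s - f t) <= K * Rabs (s - t)) -> forall t, continuous f t.
Proof.
  intros H t. apply continuity_pt_filterlim. intros eps Heps.
  assert (K0 : 0 < Rabs K + 1) by (generalize (Rabs_pos K); lra).
  exists (eps / (Rabs K + 1)). split; [apply Rdiv_lt_0_compat; lra|].
  intros s [_ Hs]. simpl in *. unfold R_dist in *.
  eapply Rle_lt_trans; [apply H|].
  apply Rle_lt_trans with ((Rabs K + 1) * Rabs (s - t)).
  - apply Rmult_le_compat_r; [apply Rabs_pos|]. generalize (Rle_abs K). lra.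
  - apply Rmult_lt_compat_l with (r := Rabs K + 1) in Hs; auto.
    replace ((Rabs K + 1) * (eps / (Rabs K + 1))) with eps in Hs by (field; lra). exact Hs.
Qed.

Lemma is_derive_primitive (h : R -> R) (a : R) :
  (forall t, continuous h t) -> forall u, is_derive (fun w => RInt h a w) u (h u).
Proof.
  intros H u. apply is_derive_RInt with a; auto.
  apply filter_forall. intros w. apply RInt_correct, ex_RInt_continuous. auto.
Qed.

(** The integral operator is composed with the projection [cl] onto the interval, so that functions
    stay total and the supremum norm contracts by [K * a]. The class requires a fixed Lipschitz
    constant because, unlike continuity, this passes to pointwise limits. *)
Lemma picard_lindelof (F : R -> R -> R) (K B a u1 v1 : R) :
  0 < a -> 0 <= K -> K * a <= / 2 ->
  (forall u v u' v', Rabs (F u v - F u' v') <= K * (Rabs (u - u') + Rabs (v - v'))) ->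
  (forall u v, Rabs (F u v) <= B) ->
  exists V, V u1 = v1 /\ forall u, Rabs (u - u1) <= a -> is_derive V u (F u (V u)).
Proof.
  intros Ha HK Ka FL FB.
  assert (B0 : 0 <= B) by (generalize (FB 0 0) (Rabs_pos (F 0 0)); lra).
  set (lip := fun f : R -> R => forall s t, Rabs (f s - f t) <= B * Rabs (s - t)).
  set (prim := fun (f : R -> R) u => v1 + RInt (fun t => F t (f t)) u1 u).
  set (cl := clamp (u1 - a) (u1 + a)).
  assert (D : forall f, lip f -> forall u, is_derive (prim f) u (F u (f u))).
  { intros f Hf u.
    replace (F u (f u)) with (plus zero (F u (f u))) by apply plus_zero_l.
    apply (is_derive_plus (fun _ => v1)); [apply (is_derive_const v1 u)|].
    apply (is_derive_primitive (fun t => F t (f t))).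
    apply lipschitz_continuous with (K * (1 + B)). intros s t.
    eapply Rle_trans; [apply FL|]. rewrite Rmult_assoc. apply Rmult_le_compat_l; auto.
    generalize (Hf s t). lra. }
  assert (P1 : forall f, prim f u1 = v1).
  { intros f. unfold prim. rewrite RInt_point. unfold zero. simpl. ring. }
  assert (C1 : cl u1 = u1) by (apply clamp_id; lra).
  assert (Cd : forall t, Rabs (cl t - u1) <= a).
  { intros t. apply Rabs_le_between. generalize (clamp_range (u1 - a) (u1 + a) t). unfold cl. lra. }
  assert (PL : forall f, lip f -> lip (fun t => prim f (cl t))).
  { intros f Hf s t. apply Rle_trans with (B * Rabs (cl s - cl t)).
    - apply mvt_bound0 with (fun u => F u (f u)). auto.
    - apply Rmult_le_compat_l; auto. apply clamp_lipschitz. }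
  destruct (contraction_fixed_point R
    (fun f => (forall t, Rabs (f t) <= Rabs v1 + B * a) /\ lip f)
    (fun f t => prim f (cl t)) (fun _ => v1) (Rabs v1 + B * a)) as (f & [_ Lf] & Ef).
  - split; [intros _; nra|]. intros s t. rewrite Rminus_diag, Rabs_R0.
    generalize (Rabs_pos (s - t)). nra.
  - intros f t [H _]. apply H.
  - intros f [_ H]. split; [|apply PL, H]. intros t.
    replace (prim f (cl t)) with (v1 + (prim f (cl t) - prim f (cl u1))) by (rewrite C1, P1; ring).
    eapply Rle_trans; [apply Rabs_triang|]. apply Rplus_le_compat_l.
    apply Rle_trans with (B * Rabs (cl t - cl u1)).
    + apply mvt_bound0 with (fun u => F u (f u)). auto.
    + apply Rmult_le_compat_l; auto. rewrite C1. apply Cd.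
  - intros f g c [_ Hf] [_ Hg] H t.
    replace (prim f (cl t) - prim g (cl t))
      with ((prim f (cl t) - prim g (cl t)) - (prim f u1 - prim g u1)) by (rewrite !P1; ring).
    assert (c0 : 0 <= c) by (generalize (H 0) (Rabs_pos (f 0 - g 0)); lra).
    apply Rle_trans with (K * c * Rabs (cl t - u1)).
    + apply (mvt_bound0 (fun u => prim f u - prim g u) (fun u => F u (f u) - F u (g u))).
      intros s _. split.
      * apply (is_derive_minus (prim f) (prim g)); auto.
      * eapply Rle_trans; [apply FL|]. rewrite Rminus_diag, Rabs_R0, Rplus_0_l.
        apply Rmult_le_compat_l; auto.
    + apply Rle_trans with (K * c * a); [|nra].
      apply Rmult_le_compat_l; [nra|apply Cd].
  - intros s f Hs L. split.
    + intros t. apply Rabs_le_between.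
      apply is_lim_seq_bounds with (fun n => s n t); auto.
      intros n. apply Rabs_le_between, Hs.
    + intros x y. apply Rabs_le_between.
      apply is_lim_seq_bounds with (fun n => s n x - s n y).
      * intros n. apply Rabs_le_between. apply (proj2 (Hs n)).
      * apply is_lim_seq_minus'; auto.
  (* The fixed point [f] is frozen outside the interval and may have a kink at its ends; [prim f]
     agrees with it inside and has a two-sided derivative even there. *)
  - exists (prim f). split; [apply P1|]. intros u Hu.
    assert (E : prim f u = f u).
    { rewrite <- (Ef u). f_equal. symmetry. apply clamp_id. apply Rabs_le_between in Hu. lra. }
    rewrite E. apply D, Lf.
Qed.

(** * Areas swept out along and across horizontal leaves *)

Lemma Rabs_mult_le a b x y : Rabs a <= x -> Rabs b <= y -> Rabs (a * b) <= x * y.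
Proof.
  intros Ha Hb. rewrite Rabs_mult. apply Rmult_le_compat; auto using Rabs_pos.
Qed.

Lemma Rabs_between s a b : Rmin a b <= s <= Rmax a b -> Rabs (s - a) <= Rabs (b - a).
Proof.
  unfold Rmin, Rmax. destruct (Rle_dec a b); intros H; unfold Rabs;
  repeat destruct (Rcase_abs _); lra.
Qed.

(** Horizontality reduces the derivative of the swept area to half the cross product of horizontal
    displacement and velocity. Both are nearly multiples of the same vector with components [wx] and
    [wy], so a factor [eps] is gained over the trivial quadratic bound. *)
Lemma horizontal_area (X Y Z dX dY dZ : R -> R) (wx wy eps a b : R) :
  0 <= eps ->
  (forall s, Rmin a b <= s <= Rmax a b ->
     is_derive X s (dX s) /\ is_derive Y s (dY s) /\ is_derive Z s (dZ s) /\
     dZ s = / 2 * (X s * dY s - Y s * dX s) /\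
     Rabs (dX s - wx) <= eps /\ Rabs (dY s - wy) <= eps) ->
  Rabs (X b - X a - wx * (b - a)) <= eps * Rabs (b - a) /\
  Rabs (Y b - Y a - wy * (b - a)) <= eps * Rabs (b - a) /\
  Rabs (Z b - Z a + / 2 * (X b * Y a - X a * Y b)) <=
    eps * (Rabs wx + Rabs wy + eps) * Rabs (b - a) * Rabs (b - a).
Proof.
  intros He H.
  assert (S : forall s, Rmin a b <= s <= Rmax a b -> forall t, Rmin a s <= t <= Rmax a s ->
                Rmin a b <= t <= Rmax a b).
  { intros s Hs t. revert Hs. unfold Rmin, Rmax. repeat destruct (Rle_dec _ _); lra. }
  assert (HX : forall s, Rmin a b <= s <= Rmax a b ->
            Rabs (X s - X a - wx * (s - a)) <= eps * Rabs (s - a)).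
  { intros s Hs. apply mvt_bound with dX. intros t Ht. split; apply H; eauto. }
  assert (HY : forall s, Rmin a b <= s <= Rmax a b ->
            Rabs (Y s - Y a - wy * (s - a)) <= eps * Rabs (s - a)).
  { intros s Hs. apply mvt_bound with dY. intros t Ht. split; apply H; eauto. }
  assert (Hb : Rmin a b <= b <= Rmax a b) by (split; [apply Rmin_r|apply Rmax_r]).
  split; [|split]; auto.
  set (E := fun s => Z s - Z a + / 2 * (X s * Y a - X a * Y s)).
  replace (Z b - Z a + / 2 * (X b * Y a - X a * Y b)) with (E b - E a) by (unfold E; field).
  apply mvt_bound0 with (fun s => dZ s + / 2 * (dX s * Y a - X a * dY s)).
  intros s Hs. destruct (H s Hs) as (D1 & D2 & D3 & Eq & B1 & B2). split.
  - unfold E. auto_derive.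
    + repeat split; eexists; eassumption.
    + assert (U1 : Derive (fun t : R => X t) s = dX s) by (apply is_derive_unique, D1).
      assert (U2 : Derive (fun t : R => Y t) s = dY s) by (apply is_derive_unique, D2).
      assert (U3 : Derive (fun t : R => Z t) s = dZ s) by (apply is_derive_unique, D3).
      rewrite U1, U2, U3. field.
  - rewrite Eq. specialize (HX s Hs). specialize (HY s Hs).
    assert (L := Rabs_between s a b Hs).
    apply Rle_trans with (eps * (Rabs wx + Rabs wy + eps) * Rabs (s - a)).
    2:{ apply Rmult_le_compat_l; auto. generalize (Rabs_pos wx) (Rabs_pos wy). nra. }
    set (n1 := dX s - wx) in *. set (n2 := dY s - wy) in *.
    set (x1 := X s - X a - wx * (s - a)) in *. set (x2 := Y s - Y a - wy * (s - a)) in *.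
    (* The two main terms [wx * wy * (s - a)] cancel; everything left contains a deviation from the
       constant velocity. *)
    replace (/ 2 * (X s * dY s - Y s * dX s) + / 2 * (dX s * Y a - X a * dY s))
      with (/ 2 * (wy * x1 + n2 * (wx * (s - a)) + n2 * x1 - (wx * x2 + n1 * (wy * (s - a)) + n1 * x2)))
      by (unfold n1, n2, x1, x2; ring).
    set (k := Rabs (s - a)) in *.
    assert (T1 : Rabs (wy * x1) <= Rabs wy * (eps * k)) by (apply Rabs_mult_le; auto; lra).
    assert (T2 : Rabs (n2 * (wx * (s - a))) <= eps * (Rabs wx * k)).
    { apply Rabs_mult_le; auto. rewrite Rabs_mult. apply Rle_refl. }
    assert (T3 : Rabs (n2 * x1) <= eps * (eps * k)) by (apply Rabs_mult_le; auto).
    assert (T4 : Rabs (wx * x2) <= Rabs wx * (eps * k)) by (apply Rabs_mult_le; auto; lra).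
    assert (T5 : Rabs (n1 * (wy * (s - a))) <= eps * (Rabs wy * k)).
    { apply Rabs_mult_le; auto. rewrite Rabs_mult. apply Rle_refl. }
    assert (T6 : Rabs (n1 * x2) <= eps * (eps * k)) by (apply Rabs_mult_le; auto).
    apply Rabs_le_between in T1, T2, T3, T4, T5, T6. apply Rabs_le_between. lra.
Qed.

(** Without horizontality the derivative of the area is the contact form of the velocity, close to
    [beta], plus a cross product of size at most [K ^ 2 * Rabs (b - a)]; the area therefore grows
    linearly. *)
Lemma transverse_area (X Y Z dX dY dZ : R -> R) (K beta eps a b : R) :
  (forall s, Rmin a b <= s <= Rmax a b ->
     is_derive X s (dX s) /\ is_derive Y s (dY s) /\ is_derive Z s (dZ s) /\
     Rabs (dZ s - / 2 * (X s * dY s - Y s * dX s) - beta) <= eps /\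
     Rabs (dX s) <= K /\ Rabs (dY s) <= K) ->
  Rabs (X b - X a) <= K * Rabs (b - a) /\
  Rabs (Y b - Y a) <= K * Rabs (b - a) /\
  Rabs (Z b - Z a + / 2 * (X b * Y a - X a * Y b) - beta * (b - a)) <=
    (eps + K ^ 2 * Rabs (b - a)) * Rabs (b - a).
Proof.
  intros H.
  assert (S : forall s, Rmin a b <= s <= Rmax a b -> forall t, Rmin a s <= t <= Rmax a s ->
                Rmin a b <= t <= Rmax a b).
  { intros s Hs t. revert Hs. unfold Rmin, Rmax. repeat destruct (Rle_dec _ _); lra. }
  assert (HX : forall s, Rmin a b <= s <= Rmax a b -> Rabs (X s - X a) <= K * Rabs (s - a)).
  { intros s Hs. apply mvt_bound0 with dX. intros t Ht. split; apply H; eauto. }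
  assert (HY : forall s, Rmin a b <= s <= Rmax a b -> Rabs (Y s - Y a) <= K * Rabs (s - a)).
  { intros s Hs. apply mvt_bound0 with dY. intros t Ht. split; apply H; eauto. }
  assert (Hb : Rmin a b <= b <= Rmax a b) by (split; [apply Rmin_r|apply Rmax_r]).
  split; [|split]; auto.
  set (E := fun s => Z s - Z a + / 2 * (X s * Y a - X a * Y s)).
  replace (Z b - Z a + / 2 * (X b * Y a - X a * Y b)) with (E b - E a) by (unfold E; field).
  apply mvt_bound with (fun s => dZ s + / 2 * (dX s * Y a - X a * dY s)).
  intros s Hs. destruct (H s Hs) as (D1 & D2 & D3 & B0 & B1 & B2). split.
  - unfold E. auto_derive.
    + repeat split; eexists; eassumption.
    + assert (U1 : Derive (fun t : R => X t) s = dX s) by (apply is_derive_unique, D1).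
      assert (U2 : Derive (fun t : R => Y t) s = dY s) by (apply is_derive_unique, D2).
      assert (U3 : Derive (fun t : R => Z t) s = dZ s) by (apply is_derive_unique, D3).
      rewrite U1, U2, U3. field.
  - specialize (HX s Hs). specialize (HY s Hs).
    assert (L := Rabs_between s a b Hs).
    assert (K0 : 0 <= K) by (generalize (Rabs_pos (dX s)); lra).
    assert (T1 : Rabs (dY s * (X s - X a)) <= K * (K * Rabs (b - a))).
    { apply Rabs_mult_le; auto. nra. }
    assert (T2 : Rabs (dX s * (Y s - Y a)) <= K * (K * Rabs (b - a))).
    { apply Rabs_mult_le; auto. nra. }
    apply Rabs_le_between in T1, T2, B0. apply Rabs_le_between. simpl pow. lra.
Qed.

Lemma gronwall_ratio (D dD : R -> R) (K a b : R) :
  0 <= K -> K * Rabs (b - a) <= / 2 ->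
  (forall s, Rmin a b <= s <= Rmax a b -> is_derive D s (dD s) /\ Rabs (dD s) <= K * Rabs (D s)) ->
  Rabs (D b - D a) <= 2 * K * Rabs (b - a) * Rabs (D a).
Proof.
  intros HK Ka H.
  destruct (continuity_ab_maj (fun s => Rabs (D s)) (Rmin a b) (Rmax a b)) as (m & Hm & Im).
  - apply Rle_trans with a; [apply Rmin_l|apply Rmax_l].
  - intros c Hc. apply (continuity_pt_comp D Rabs); [|apply Rcontinuity_abs].
    apply derivable_continuous_pt. exists (dD c). apply is_derive_Reals, H, Hc.
  - assert (G : forall c, Rmin a b <= c <= Rmax a b ->
              Rabs (D c - D a) <= K * Rabs (D m) * Rabs (c - a)).
    { intros c Hc. apply mvt_bound0 with dD. intros s Hs.
      assert (Rmin a b <= s <= Rmax a b).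
      { revert Hc Hs. unfold Rmin, Rmax. repeat destruct (Rle_dec _ _); lra. }
      split; [apply H; auto|]. apply Rle_trans with (K * Rabs (D s)); [apply H; auto|].
      apply Rmult_le_compat_l; auto. }
    assert (Gm := G m Im). assert (Lm := Rabs_between m a b Im).
    assert (M0 := Rabs_pos (D m)).
    assert (B : Rabs (D m) <= 2 * Rabs (D a)).
    { assert (Rabs (D m) <= Rabs (D m - D a) + Rabs (D a)).
      { replace (D m) with ((D m - D a) + D a) at 1 by ring. apply Rabs_triang. }
      assert (K * Rabs (D m) * Rabs (m - a) <= Rabs (D m) / 2); [|lra].
      apply Rle_trans with (Rabs (D m) * (K * Rabs (b - a))); [|nra].
      rewrite (Rmult_comm K), Rmult_assoc. apply Rmult_le_compat_l; auto.
      apply Rmult_le_compat_l; auto. }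
    eapply Rle_trans; [apply G; split; [apply Rmin_r|apply Rmax_r]|].
    assert (0 <= Rabs (b - a)) by apply Rabs_pos.
    assert (0 <= K * Rabs (b - a)) by (apply Rmult_le_pos; auto). nra.
Qed.

(** The group law: vertical coordinates add up to half the cross product of the horizontal
    displacements. *)
Lemma area_split p m q : area p q = area p m + area m q +
  / 2 * ((px m - px q) * (py p - py m) - (py m - py q) * (px p - px m)).
Proof. unfold area. field. Qed.

(** The route from [q] runs along its leaf to [m], with parameter change [h], then across to [p],
    with change [delta]; [d] is the gap of the two leaves at the reference parameter. The conditions
    on [w2] absorb errors of order [h ^ 2], those on [Rabs b] errors of order [delta]. *)
Lemma adapted_of_estimates (p m q : pt) (wx wy b h delta d eps K : R) :
  let w1 := Rabs wx + Rabs wy in let w2 := wx ^ 2 + wy ^ 2 in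
  0 < eps -> eps <= / 80 -> 0 <= K ->
  400 * eps <= w2 -> 40 * (w1 + 1) * eps <= w2 ->
  400 * K * eps <= Rabs b -> 80 * (w1 + 2) * eps <= Rabs b ->
  K * Rabs h <= eps -> K * Rabs delta <= eps ->
  Rabs (px m - px q - wx * h) <= eps * Rabs h ->
  Rabs (py m - py q - wy * h) <= eps * Rabs h ->
  Rabs (area m q) <= eps * (w1 + eps) * Rabs h * Rabs h ->
  Rabs (px p - px m) <= K * Rabs delta ->
  Rabs (py p - py m) <= K * Rabs delta ->
  Rabs (area p m - b * delta) <= (eps + K ^ 2 * Rabs delta) * Rabs delta ->
  Rabs (delta - d) <= eps * Rabs d ->
  adapted p q (sqrt w2 * h) (4 * b * d).
Proof.
  intros w1 w2 He He' HK C1 C2 C3 C4 Kh Kd X1 Y1 A1 X2 Y2 A2 Hd.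
  assert (W2 : (sqrt w2 * h) ^ 2 = w2 * Rabs h ^ 2).
  { rewrite Rpow_mult_distr, pow2_sqrt, pow2_abs; [reflexivity|].
    unfold w2. generalize (pow2_ge_0 wx) (pow2_ge_0 wy). lra. }
  assert (B4 : Rabs (4 * b * d) = 4 * (Rabs b * Rabs d)).
  { rewrite !Rabs_mult, (Rabs_pos_eq 4) by lra. ring. }
  assert (h0 := Rabs_pos h). assert (d0 := Rabs_pos d). assert (D0 := Rabs_pos delta).
  assert (wx0 := Rabs_pos wx). assert (wy0 := Rabs_pos wy).
  assert (D2 : Rabs delta <= 2 * Rabs d).
  { replace delta with ((delta - d) + d) by ring. eapply Rle_trans; [apply Rabs_triang|]. nra. }
  assert (b0 : 0 <= Rabs b * Rabs d) by (apply Rmult_le_pos; auto using Rabs_pos).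
  assert (w20 : 400 * eps * Rabs h ^ 2 <= w2 * Rabs h ^ 2).
  { apply Rmult_le_compat_r; auto. apply pow2_ge_0. }
  assert (hh : 0 <= Rabs h ^ 2) by apply pow2_ge_0.
  (* One factor [K * Rabs delta] is replaced by [eps]; the other stays linear in [d] and is charged
     to the vertical term. *)
  assert (KK : 400 * (K * Rabs delta) ^ 2 <= 2 * (Rabs b * Rabs d)).
  { apply Rle_trans with (400 * (eps * (K * (2 * Rabs d)))).
    - simpl pow. rewrite Rmult_1_r. apply Rmult_le_compat_l; [lra|].
      apply Rmult_le_compat; auto; try (apply Rmult_le_pos; auto).
      apply Rmult_le_compat_l; auto.
    - assert (400 * K * eps * Rabs d <= Rabs b * Rabs d) by (apply Rmult_le_compat_r; auto). lra. }
  assert (EE : forall e, Rabs e <= eps * Rabs h + K * Rabs delta ->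
            e ^ 2 <= w2 * Rabs h ^ 2 / 1000 + Rabs b * Rabs d / 100).
  { intros e E. rewrite <- pow2_abs.
    apply Rle_trans with ((eps * Rabs h + K * Rabs delta) ^ 2).
    - apply pow_incr. split; auto. apply Rabs_pos.
    - apply Rle_trans with (2 * (eps * Rabs h) ^ 2 + 2 * (K * Rabs delta) ^ 2).
      + generalize (pow2_ge_0 (eps * Rabs h - K * Rabs delta)). lra.
      + assert ((eps * Rabs h) ^ 2 <= eps * Rabs h ^ 2 / 80); [|]. 2:{ clear - H KK w20 b0 hh. nra. }
        rewrite Rpow_mult_distr. apply Rle_trans with (eps / 80 * Rabs h ^ 2); [|lra].
        apply Rmult_le_compat_r; auto. simpl. rewrite Rmult_1_r.
        apply Rmult_le_compat_l; lra. }
  assert (EX := EE (px p - px q - wx * h)). assert (EY := EE (py p - py q - wy * h)).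
  assert (TX : Rabs (px p - px q - wx * h) <= eps * Rabs h + K * Rabs delta).
  { replace (px p - px q - wx * h) with ((px m - px q - wx * h) + (px p - px m)) by ring.
    eapply Rle_trans; [apply Rabs_triang|]. lra. }
  assert (TY : Rabs (py p - py q - wy * h) <= eps * Rabs h + K * Rabs delta).
  { replace (py p - py q - wy * h) with ((py m - py q - wy * h) + (py p - py m)) by ring.
    eapply Rle_trans; [apply Rabs_triang|]. lra. }
  specialize (EX TX). specialize (EY TY).
  assert (EQ : w2 * Rabs h ^ 2 = (wx * h) ^ 2 + (wy * h) ^ 2).
  { rewrite pow2_abs. unfold w2. ring. }
  unfold adapted. rewrite W2, B4. split; [|split].
  - unfold hdist2.
    revert EX EY EQ. clear - w20 b0 hh He.
    generalize (px p - px q) (py p - py q) (wx * h) (wy * h). intros x y wx' wy' EX EY EQ.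
    generalize (pow2_ge_0 (x - 2 * wx')) (pow2_ge_0 (y - 2 * wy')). nra.
  - unfold hdist2. revert EX EY EQ. clear - w20 b0 hh He.
    generalize (px p - px q) (py p - py q) (wx * h) (wy * h). intros x y wx' wy' EX EY EQ.
    generalize (pow2_ge_0 (2 * x - wx')) (pow2_ge_0 (2 * y - wy')). nra.
  - rewrite (area_split p m q).
    set (T3 := (px m - px q) * (py p - py m) - (py m - py q) * (px p - px m)).
    assert (C3' : 400 * K * eps * Rabs d <= Rabs b * Rabs d) by (apply Rmult_le_compat_r; auto).
    assert (C4' : 80 * (w1 + 2) * eps * Rabs d <= Rabs b * Rabs d) by (apply Rmult_le_compat_r; auto).
    assert (w1d : 0 <= w1 * eps * Rabs d).
    { apply Rmult_le_pos; auto. apply Rmult_le_pos; unfold w1; lra. }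
    assert (ed : 0 <= eps * Rabs d) by (apply Rmult_le_pos; lra).
    assert (B1 : Rabs (area p m - b * delta) <= (Rabs b * Rabs d) * (3 / 100)).
    { eapply Rle_trans; [apply A2|].
      apply Rle_trans with ((eps + K * eps) * (2 * Rabs d)); [|lra].
      apply Rmult_le_compat; auto.
      - assert (0 <= K ^ 2 * Rabs delta) by (apply Rmult_le_pos; auto; apply pow2_ge_0). lra.
      - apply Rplus_le_compat_l. simpl. rewrite Rmult_1_r, Rmult_assoc. apply Rmult_le_compat_l; auto. }
    assert (B2 : Rabs (area m q) <= w2 * Rabs h ^ 2 / 40).
    { eapply Rle_trans; [apply A1|]. rewrite Rmult_assoc.
      replace (Rabs h * Rabs h) with (Rabs h ^ 2) by ring.
      replace (w2 * Rabs h ^ 2 / 40) with (w2 / 40 * Rabs h ^ 2) by field.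
      apply Rmult_le_compat_r; auto. nra. }
    assert (B3 : Rabs T3 <= Rabs b * Rabs d / 20).
    { assert (M1 : Rabs (px m - px q) <= (Rabs wx + eps) * Rabs h).
      { replace (px m - px q) with ((px m - px q - wx * h) + wx * h) by ring.
        eapply Rle_trans; [apply Rabs_triang|]. rewrite Rabs_mult. lra. }
      assert (M2 : Rabs (py m - py q) <= (Rabs wy + eps) * Rabs h).
      { replace (py m - py q) with ((py m - py q - wy * h) + wy * h) by ring.
        eapply Rle_trans; [apply Rabs_triang|]. rewrite Rabs_mult. lra. }
      assert (N1 := Rabs_mult_le _ _ _ _ M1 Y2). assert (N2 := Rabs_mult_le _ _ _ _ M2 X2).
      (* The mixed area, of order [h * delta]: bounding [K * Rabs h] by [eps] leaves a small
         multiple of [delta]. *)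
      apply Rle_trans with ((w1 + 2 * eps) * (K * Rabs h) * Rabs delta).
      - unfold T3, w1. apply Rabs_le_between in N1, N2. apply Rabs_le_between. lra.
      - apply Rle_trans with ((w1 + 2 * eps) * eps * (2 * Rabs d)).
        + apply Rmult_le_compat; auto.
          * apply Rmult_le_pos; [unfold w1; lra|]. apply Rmult_le_pos; auto.
          * apply Rmult_le_compat_l; [unfold w1; lra|]. auto.
        + assert (eps * (eps * Rabs d) <= / 80 * (eps * Rabs d)) by (apply Rmult_le_compat_r; auto).
          lra. }
    assert (B5 : Rabs (b * (delta - d)) <= Rabs b * Rabs d / 80).
    { rewrite Rabs_mult. apply Rle_trans with (Rabs b * (eps * Rabs d)).
      - apply Rmult_le_compat_l; auto using Rabs_pos.
      - assert (eps * (Rabs b * Rabs d) <= / 80 * (Rabs b * Rabs d)) by (apply Rmult_le_compat_r; auto).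
        lra. }
    replace (4 * (area p m + area m q + / 2 * T3) - 4 * b * d)
      with (4 * ((area p m - b * delta) + area m q + / 2 * T3 + b * (delta - d))) by ring.
    apply Rabs_le_between in B1, B2, B3, B5. apply Rabs_le_between. lra.
Qed.

(** * Parametrized surface patches *)

Definition box (u0 v0 r u v : R) : Prop := Rabs (u - u0) <= r /\ Rabs (v - v0) <= r.

(** A sup bound is bundled with the Lipschitz bound, which makes the class closed under products. *)
Definition lip_with (P : R -> R -> Prop) (K : R) (f : R -> R -> R) : Prop :=
  forall u v, P u v -> Rabs (f u v) <= K /\
    forall u' v', P u' v' -> Rabs (f u v - f u' v') <= K * (Rabs (u - u') + Rabs (v - v')).

Definition lipb (P : R -> R -> Prop) (f : R -> R -> R) : Prop := exists K, 0 <= K /\ lip_with P K f.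

Lemma lip_with_le P K K' f : K <= K' -> lip_with P K f -> lip_with P K' f.
Proof.
  intros HK H u v Huv. destruct (H u v Huv) as [H1 H2]. split; [lra|].
  intros u' v' H'. eapply Rle_trans; [apply H2, H'|].
  apply Rmult_le_compat_r; auto. generalize (Rabs_pos (u - u')) (Rabs_pos (v - v')). lra.
Qed.

Lemma lip_with_sub P Q K f : (forall u v, Q u v -> P u v) -> lip_with P K f -> lip_with Q K f.
Proof.
  intros HPQ H u v Huv. split; [apply H; auto|]. intros u' v' H'. apply H; auto.
Qed.

Lemma lipb_sub P Q f : (forall u v, Q u v -> P u v) -> lipb P f -> lipb Q f.
Proof. intros HPQ (K & K0 & H). exists K. split; auto. eapply lip_with_sub; eauto. Qed.

Lemma lipb_const P c : lipb P (fun _ _ => c).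
Proof.
  exists (Rabs c). split; [apply Rabs_pos|]. intros u v _. split; [lra|]. intros u' v' _.
  rewrite Rminus_diag, Rabs_R0. apply Rmult_le_pos; [apply Rabs_pos|].
  generalize (Rabs_pos (u - u')) (Rabs_pos (v - v')). lra.
Qed.

Lemma lipb_plus P f g : lipb P f -> lipb P g -> lipb P (fun u v => f u v + g u v).
Proof.
  intros (K & K0 & Hf) (L & L0 & Hg). exists (K + L). split; [lra|]. intros u v Huv.
  destruct (Hf u v Huv) as [F1 F2], (Hg u v Huv) as [G1 G2]. split.
  - eapply Rle_trans; [apply Rabs_triang|]. lra.
  - intros u' v' H'. specialize (F2 u' v' H'). specialize (G2 u' v' H').
    replace (f u v + g u v - (f u' v' + g u' v')) with ((f u v - f u' v') + (g u v - g u' v')) by ring.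
    eapply Rle_trans; [apply Rabs_triang|]. lra.
Qed.

Lemma lipb_mult P f g : lipb P f -> lipb P g -> lipb P (fun u v => f u v * g u v).
Proof.
  intros (K & K0 & Hf) (L & L0 & Hg). exists (2 * K * L).
  split; [apply Rmult_le_pos; lra|]. intros u v Huv.
  destruct (Hf u v Huv) as [F1 F2], (Hg u v Huv) as [G1 G2].
  assert (KL : 0 <= K * L) by (apply Rmult_le_pos; auto). split.
  - apply Rle_trans with (K * L); [apply Rabs_mult_le; auto|lra].
  - intros u' v' H'. specialize (F2 u' v' H'). specialize (G2 u' v' H').
    destruct (Hf u' v' H') as [F1' _].
    replace (f u v * g u v - f u' v' * g u' v')
      with ((f u v - f u' v') * g u v + f u' v' * (g u v - g u' v')) by ring.
    eapply Rle_trans; [apply Rabs_triang|].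
    generalize (Rabs_mult_le _ _ _ _ F2 G1) (Rabs_mult_le _ _ _ _ F1' G2). lra.
Qed.

Lemma lipb_minus P f g : lipb P f -> lipb P g -> lipb P (fun u v => f u v - g u v).
Proof.
  intros Hf Hg.
  destruct (lipb_plus P f (fun u v => -1 * g u v) Hf) as (K & K0 & H).
  - apply (lipb_mult P (fun _ _ => -1)); auto. apply lipb_const.
  - exists K. split; auto. intros u v Huv. destruct (H u v Huv) as [H1 H2]. split.
    + replace (f u v - g u v) with (f u v + -1 * g u v) by ring. auto.
    + intros u' v' H'. specialize (H2 u' v' H').
      replace (f u v - g u v - (f u' v' - g u' v'))
        with (f u v + -1 * g u v - (f u' v' + -1 * g u' v')) by ring. auto.
Qed.

Lemma lipb_inv P f m : 0 < m -> (forall u v, P u v -> m <= Rabs (f u v)) ->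
  lipb P f -> lipb P (fun u v => / f u v).
Proof.
  intros Hm Hf (K & K0 & H). exists (K * (/ m * / m) + / m).
  assert (m0 : 0 < / m) by (apply Rinv_0_lt_compat, Hm).
  assert (mm : 0 < / m * / m) by (apply Rmult_lt_0_compat; auto).
  assert (Km : 0 <= K * (/ m * / m)) by (apply Rmult_le_pos; lra).
  split; [lra|]. intros u v Huv. destruct (H u v Huv) as [H1 H2].
  assert (I : forall u v, P u v -> f u v <> 0 /\ Rabs (/ f u v) <= / m).
  { intros a b Hab. specialize (Hf a b Hab). split.
    - intros E. rewrite E, Rabs_R0 in Hf. lra.
    - rewrite Rabs_inv. apply Rinv_le_contravar; auto. }
  destruct (I u v Huv) as [N1 I1]. split; [lra|]. intros u' v' H'.
  destruct (I u' v' H') as [N2 I2]. specialize (H2 u' v' H').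
  replace (/ f u v - / f u' v') with (- (f u v - f u' v') * (/ f u v * / f u' v')) by (field; auto).
  assert (S : 0 <= Rabs (u - u') + Rabs (v - v')).
  { generalize (Rabs_pos (u - u')) (Rabs_pos (v - v')). lra. }
  apply Rle_trans with (K * (Rabs (u - u') + Rabs (v - v')) * (/ m * / m)).
  - apply Rabs_mult_le; [rewrite Rabs_Ropp; auto|]. apply Rabs_mult_le; auto.
  - assert (0 <= / m * (Rabs (u - u') + Rabs (v - v'))) by (apply Rmult_le_pos; lra). lra.
Qed.

Lemma box_between u0 v0 r u v u' v' s : box u0 v0 r u v -> box u0 v0 r u' v' ->
  (Rmin u u' <= s <= Rmax u u' -> Rabs (s - u0) <= r) /\
  (Rmin v v' <= s <= Rmax v v' -> Rabs (s - v0) <= r).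
Proof.
  intros [H1 H2] [H3 H4]. apply Rabs_le_between in H1, H2, H3, H4.
  split; intros H; apply Rabs_le_between; revert H; unfold Rmin, Rmax;
  destruct (Rle_dec _ _); lra.
Qed.

Definition has_partials (u0 v0 r : R) (f fu fv : R -> R -> R) : Prop :=
  forall u v, box u0 v0 r u v ->
    is_derive (fun s => f s v) u (fu u v) /\ is_derive (fun s => f u s) v (fv u v).

Lemma lipb_of_lipschitz u0 v0 r K f : 0 <= r ->
  (forall u v u' v', box u0 v0 r u v -> box u0 v0 r u' v' ->
     Rabs (f u v - f u' v') <= K * (Rabs (u - u') + Rabs (v - v'))) ->
  lipb (box u0 v0 r) f.
Proof.
  intros Hr Lip.
  assert (B0 : box u0 v0 r u0 v0) by (split; rewrite Rminus_diag, Rabs_R0; auto).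
  assert (A0 := Rabs_pos K). assert (F0 := Rabs_pos (f u0 v0)).
  assert (M0 : 0 <= Rabs (f u0 v0) + Rabs K * (r + r)) by nra.
  exists (Rabs K + (Rabs (f u0 v0) + Rabs K * (r + r))). split; [lra|].
  assert (L' : forall u v u' v', box u0 v0 r u v -> box u0 v0 r u' v' ->
            Rabs (f u v - f u' v') <= Rabs K * (Rabs (u - u') + Rabs (v - v'))).
  { intros u v u' v' H H'. eapply Rle_trans; [apply Lip; auto|].
    apply Rmult_le_compat_r; [|apply Rle_abs].
    generalize (Rabs_pos (u - u')) (Rabs_pos (v - v')). lra. }
  intros u v Huv. split.
  - assert (G := L' u v u0 v0 Huv B0).
    replace (f u v) with ((f u v - f u0 v0) + f u0 v0) by ring.
    eapply Rle_trans; [apply Rabs_triang|]. destruct Huv. nra.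
  - intros u' v' H'. eapply Rle_trans; [apply L'; auto|]. apply Rmult_le_compat_r; [|lra].
    generalize (Rabs_pos (u - u')) (Rabs_pos (v - v')). lra.
Qed.

Lemma lipb_of_partials u0 v0 r f fu fv : 0 <= r -> has_partials u0 v0 r f fu fv ->
  lipb (box u0 v0 r) fu -> lipb (box u0 v0 r) fv -> lipb (box u0 v0 r) f.
Proof.
  intros Hr H (K & K0 & HK) (L & L0 & HL).
  apply lipb_of_lipschitz with (K + L); auto.
  intros u v u' v' H1 H2.
  assert (X1 : Rabs (f u v - f u' v) <= K * Rabs (u - u')).
  { apply (mvt_bound0 (fun s => f s v) (fun s => fu s v) u' u). intros s Hs.
    assert (box u0 v0 r s v).
    { split; [|apply H1]. eapply (box_between u0 v0 r u' v' u v); eauto. }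
    split; [apply H; auto|]. apply HK; auto. }
  assert (X2 : Rabs (f u' v - f u' v') <= L * Rabs (v - v')).
  { apply (mvt_bound0 (fun s => f u' s) (fun s => fv u' s) v' v). intros s Hs.
    assert (box u0 v0 r u' s).
    { split; [apply H2|]. eapply (box_between u0 v0 r u' v' u v); eauto. }
    split; [apply H; auto|]. apply HL; auto. }
  replace (f u v - f u' v') with ((f u v - f u' v) + (f u' v - f u' v')) by ring.
  eapply Rle_trans; [apply Rabs_triang|].
  generalize (Rabs_pos (u - u')) (Rabs_pos (v - v')). nra.
Qed.

(** The increment is split into a leg in each variable. On each leg the partial differs from its
    value at the base point by a multiple of the step, so the error is quadratic. *)
Lemma differentiable_of_partials u0 v0 r f fu fv u v :
  has_partials u0 v0 r f fu fv -> lipb (box u0 v0 r) fu -> lipb (box u0 v0 r) fv ->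
  Rabs (u - u0) < r -> Rabs (v - v0) < r ->
  differentiable_pt_lim f u v (fu u v) (fv u v).
Proof.
  intros H (K & K0 & HK) (L & L0 & HL) Hu Hv eps.
  assert (Hd : 0 < Rmin (Rmin (r - Rabs (u - u0)) (r - Rabs (v - v0))) (eps / (2 * K + L + 1))).
  { repeat apply Rmin_glb_lt; try lra. apply Rdiv_lt_0_compat; [apply cond_pos|lra]. }
  exists (mkposreal _ Hd). simpl. intros s t Hs Ht.
  apply Rmin_Rgt_l in Hs, Ht. destruct Hs as [Hs He], Ht as [Ht He'].
  apply Rmin_Rgt_l in Hs, Ht.
  assert (B : box u0 v0 r u v) by (split; lra).
  assert (B' : box u0 v0 r s t).
  { split.
    - replace (s - u0) with ((s - u) + (u - u0)) by ring.
      eapply Rle_trans; [apply Rabs_triang|]. lra.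
    - replace (t - v0) with ((t - v) + (v - v0)) by ring.
      eapply Rle_trans; [apply Rabs_triang|]. lra. }
  assert (He2 : Rabs (s - u) * (2 * K + L + 1) <= eps /\ Rabs (t - v) * (2 * K + L + 1) <= eps).
  { split; apply Rmult_le_reg_r with (/ (2 * K + L + 1)); try (apply Rinv_0_lt_compat; lra);
    rewrite Rmult_assoc, Rinv_r by lra; rewrite Rmult_1_r; apply Rlt_le; auto. }
  set (m := Rmax (Rabs (s - u)) (Rabs (t - v))).
  assert (m1 : Rabs (s - u) <= m) by apply Rmax_l.
  assert (m2 : Rabs (t - v) <= m) by apply Rmax_r.
  assert (m3 : m * (2 * K + L + 1) <= eps).
  { unfold m, Rmax. destruct (Rle_dec _ _); apply He2. }
  assert (s0 := Rabs_pos (s - u)). assert (t0 := Rabs_pos (t - v)).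
  assert (X1 : Rabs (f s t - f u t - fu u v * (s - u)) <= 2 * K * m * Rabs (s - u)).
  { apply (mvt_bound (fun x => f x t) (fun x => fu x t) u s). intros x Hx.
    assert (Bx : box u0 v0 r x t).
    { split; [|apply B']. eapply (box_between u0 v0 r u v s t); eauto. }
    split; [apply H; auto|].
    eapply Rle_trans; [apply HK; auto|]. rewrite (Rmult_comm 2), Rmult_assoc.
    apply Rmult_le_compat_l; auto. generalize (Rabs_between x u s Hx). lra. }
  assert (X2 : Rabs (f u t - f u v - fv u v * (t - v)) <= L * m * Rabs (t - v)).
  { apply (mvt_bound (fun x => f u x) (fun x => fv u x) v t). intros x Hx.
    assert (Bx : box u0 v0 r u x).
    { split; [apply B|]. eapply (box_between u0 v0 r u v s t); eauto. }
    split; [apply H; auto|].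
    eapply Rle_trans; [apply HL; auto|]. apply Rmult_le_compat_l; auto.
    rewrite Rminus_diag, Rabs_R0. generalize (Rabs_between x v t Hx). lra. }
  replace (f s t - f u v - (fu u v * (s - u) + fv u v * (t - v)))
    with ((f s t - f u t - fu u v * (s - u)) + (f u t - f u v - fv u v * (t - v))) by ring.
  eapply Rle_trans; [apply Rabs_triang|].
  assert (0 <= 2 * K * m) by nra. assert (0 <= L * m) by nra.
  apply Rle_trans with ((2 * K * m + L * m) * m); [nra|].
  apply Rmult_le_compat_r; lra.
Qed.

Lemma is_derive_along u0 v0 r f fu fv (V : R -> R) u d :
  has_partials u0 v0 r f fu fv -> lipb (box u0 v0 r) fu -> lipb (box u0 v0 r) fv ->
  Rabs (u - u0) < r -> Rabs (V u - v0) < r -> is_derive V u d ->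
  is_derive (fun s => f s (V s)) u (fu u (V u) + fv u (V u) * d).
Proof.
  intros H Hu Hv Bu Bv HV. apply is_derive_Reals.
  replace (fu u (V u) + fv u (V u) * d) with (fu u (V u) * 1 + fv u (V u) * d) by ring.
  apply (derivable_pt_lim_comp_2d f (fun s => s) V).
  - eapply differentiable_of_partials; eauto.
  - apply derivable_pt_lim_id.
  - apply is_derive_Reals, HV.
Qed.

(** Meets a finite list of smallness conditions at once, each pair standing for
    [fst c * e <= snd c]. *)
Lemma exists_small (l : list (R * R)) : List.Forall (fun c => 0 < snd c) l ->
  exists e, 0 < e /\ List.Forall (fun c => fst c * e <= snd c) l.
Proof.
  induction l as [|[M c] l IH]; intros H.
  - exists 1. split; [lra|constructor].
  - inversion H as [|? ? Hc Hl]; subst. simpl in Hc. destruct (IH Hl) as (e & He & F).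
    assert (M0 : 0 < Rabs M + 1) by (generalize (Rabs_pos M); lra).
    assert (E0 : 0 < Rmin e (c / (Rabs M + 1))).
    { apply Rmin_glb_lt; auto. apply Rdiv_lt_0_compat; auto. }
    assert (K : forall N d, N * e <= d -> 0 < d -> N * Rmin e (c / (Rabs M + 1)) <= d).
    { intros N d HN Hd. destruct (Rle_dec N 0) as [Hn|Hn].
      - nra.
      - apply Rle_trans with (N * e); auto. apply Rmult_le_compat_l; [lra|apply Rmin_l]. }
    exists (Rmin e (c / (Rabs M + 1))). split; auto. constructor.
    + simpl. apply Rle_trans with ((Rabs M + 1) * Rmin e (c / (Rabs M + 1))).
      * apply Rmult_le_compat_r; [lra|]. generalize (Rle_abs M). lra.
      * apply Rle_trans with ((Rabs M + 1) * (c / (Rabs M + 1))).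
        -- apply Rmult_le_compat_l; [lra|apply Rmin_r].
        -- right. field. lra.
    + rewrite Forall_forall in *. intros [N d] Hin. simpl. apply K.
      * apply (F (N, d) Hin).
      * apply (Hl (N, d) Hin).
Qed.

(** * The contact form and horizontal leaves on a patch *)

Definition contact (p d : pt) : R := pz d - / 2 * (px p * py d - py p * px d).

Definition lip3 (P : R -> R -> Prop) (d : R -> R -> pt) : Prop :=
  lipb P (fun u v => px (d u v)) /\ lipb P (fun u v => py (d u v)) /\ lipb P (fun u v => pz (d u v)).

Definition patch (phi du dv : R -> R -> pt) (u0 v0 r : R) : Prop :=
  0 < r /\
  (forall u v, box u0 v0 r u v ->
     has_deriv3 (fun s => phi s v) u (du u v) /\ has_deriv3 (fun s => phi u s) v (dv u v)) /\
  lip3 (box u0 v0 r) du /\ lip3 (box u0 v0 r) dv.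

Lemma box_sub u0 v0 r r' u v : r' <= r -> box u0 v0 r' u v -> box u0 v0 r u v.
Proof. unfold box. lra. Qed.

Lemma box_center u0 v0 r : 0 <= r -> box u0 v0 r u0 v0.
Proof. intros H. split; rewrite Rminus_diag, Rabs_R0; exact H. Qed.

Lemma patch_sub phi du dv u0 v0 r r' :
  0 < r' <= r -> patch phi du dv u0 v0 r -> patch phi du dv u0 v0 r'.
Proof.
  intros [H0 H] (_ & HD & (L1 & L2 & L3) & (L4 & L5 & L6)).
  assert (S : forall u v, box u0 v0 r' u v -> box u0 v0 r u v).
  { intros u v. apply box_sub, H. }
  split; [exact H0|]. split; [auto|].
  split; (split; [|split]); eapply lipb_sub; eauto.
Qed.

Lemma patch_contact_lip phi du dv u0 v0 r : patch phi du dv u0 v0 r ->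
  lipb (box u0 v0 r) (fun u v => contact (phi u v) (du u v)) /\
  lipb (box u0 v0 r) (fun u v => contact (phi u v) (dv u v)).
Proof.
  intros (Hr & HD & (L1 & L2 & L3) & (L4 & L5 & L6)).
  assert (X : lipb (box u0 v0 r) (fun u v => px (phi u v))).
  { eapply lipb_of_partials; [lra| |exact L1|exact L4]. intros u v H. split; apply HD, H. }
  assert (Y : lipb (box u0 v0 r) (fun u v => py (phi u v))).
  { eapply lipb_of_partials; [lra| |exact L2|exact L5]. intros u v H. split; apply HD, H. }
  unfold contact. split; (apply lipb_minus; [assumption|]);
  apply (lipb_mult _ (fun _ _ => / 2)); try apply lipb_const;
  apply lipb_minus; apply lipb_mult; assumption.
Qed.

(** The value for which [du] plus this multiple of [dv] is annihilated by the contact form. *)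
Definition slope (phi du dv : R -> R -> pt) (u v : R) : R :=
  - contact (phi u v) (du u v) * / contact (phi u v) (dv u v).

Definition leafdir (phi du dv : R -> R -> pt) (u v : R) : pt :=
  add3 (du u v) (scal3 (slope phi du dv u v) (dv u v)).

(* On a smaller box the transverse contact component stays away from zero, so the horizontal
   leaves are graphs over the first parameter, solving [v' = slope u v]. *)
Lemma patch_leaf_bounds phi du dv u0 v0 r : patch phi du dv u0 v0 r ->
  contact (phi u0 v0) (dv u0 v0) <> 0 ->
  exists r' K, 0 < r' <= r /\ 1 <= K /\
    (forall u v, box u0 v0 r' u v -> contact (phi u v) (dv u v) <> 0) /\
    lip_with (box u0 v0 r') K (slope phi du dv) /\
    lip_with (box u0 v0 r') K (fun u v => contact (phi u v) (dv u v)) /\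
    lip_with (box u0 v0 r') K (fun u v => px (leafdir phi du dv u v)) /\
    lip_with (box u0 v0 r') K (fun u v => py (leafdir phi du dv u v)) /\
    lip_with (box u0 v0 r') K (fun u v => px (dv u v)) /\
    lip_with (box u0 v0 r') K (fun u v => py (dv u v)).
Proof.
  intros HP HB. assert (Hr : 0 < r) by apply HP.
  destruct (patch_contact_lip _ _ _ _ _ _ HP) as [_ (KB & KB0 & LB)].
  assert (b0 := Rabs_pos_lt _ HB). set (b := Rabs (contact (phi u0 v0) (dv u0 v0))) in *.
  set (r' := Rmin r (b / (4 * (KB + 1)))).
  assert (Hr' : 0 < r').
  { apply Rmin_glb_lt; auto. apply Rdiv_lt_0_compat; lra. }
  assert (Hrr : r' <= r) by apply Rmin_l.
  assert (Hrb : 4 * (KB + 1) * r' <= b).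
  { apply Rle_trans with (4 * (KB + 1) * (b / (4 * (KB + 1)))).
    - apply Rmult_le_compat_l; [lra|apply Rmin_r].
    - right. field. lra. }
  assert (low : forall u v, box u0 v0 r' u v -> b / 2 <= Rabs (contact (phi u v) (dv u v))).
  { intros u v H. assert (H' := box_sub _ _ _ _ _ _ Hrr H).
    destruct (LB u0 v0 (box_center u0 v0 r ltac:(lra))) as [_ G]. specialize (G u v H').
    assert (KB * (Rabs (u0 - u) + Rabs (v0 - v)) <= b / 2).
    { destruct H as [H1 H2]. rewrite (Rabs_minus_sym u0), (Rabs_minus_sym v0).
      apply Rle_trans with (KB * (2 * r')); [|lra]. apply Rmult_le_compat_l; auto. lra. }
    generalize (Rabs_triang_inv (contact (phi u0 v0) (dv u0 v0)) (contact (phi u v) (dv u v))).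
    fold b. lra. }
  assert (HP' := patch_sub _ _ _ _ _ _ r' (conj Hr' Hrr) HP).
  destruct (patch_contact_lip _ _ _ _ _ _ HP') as [LA LB'].
  assert (LS : lipb (box u0 v0 r') (slope phi du dv)).
  { unfold slope. apply lipb_mult.
    - destruct LA as (K & K0 & H). exists K. split; auto. intros u v Huv.
      destruct (H u v Huv) as [H1 H2]. split; [rewrite Rabs_Ropp; auto|].
      intros u' v' H'. specialize (H2 u' v' H'). rewrite <- Rabs_Ropp.
      replace (- _) with (contact (phi u v) (du u v) - contact (phi u' v') (du u' v')) by ring. auto.
    - apply lipb_inv with (b / 2); auto. lra. }
  destruct HP' as (_ & _ & (L1 & L2 & L3) & (L4 & L5 & L6)).
  assert (LX : lipb (box u0 v0 r') (fun u v => px (leafdir phi du dv u v))).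
  { unfold leafdir, add3, scal3, px at 1. simpl.
    apply (lipb_plus _ (fun u v => px (du u v)) (fun u v => slope phi du dv u v * px (dv u v)));
    auto using lipb_mult. }
  assert (LY : lipb (box u0 v0 r') (fun u v => py (leafdir phi du dv u v))).
  { unfold leafdir, add3, scal3, py at 1. simpl.
    apply (lipb_plus _ (fun u v => py (du u v)) (fun u v => slope phi du dv u v * py (dv u v)));
    auto using lipb_mult. }
  destruct LS as (K1 & P1 & H1), LB' as (K2 & P2 & H2), LX as (K3 & P3 & H3), LY as (K4 & P4 & H4),
    L4 as (K5 & P5 & H5), L5 as (K6 & P6 & H6).
  exists r', (1 + K1 + K2 + K3 + K4 + K5 + K6).
  split; [split; auto|]. split; [lra|]. split.
  { intros u v H E. specialize (low u v H). rewrite E, Rabs_R0 in low. lra. }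
  repeat (split; [eapply lip_with_le; [|eassumption]; lra|]).
  eapply lip_with_le; [|eassumption]; lra.
Qed.

(** [S] is controlled on the box only, so it is extended by projecting onto the box; the solution
    follows [S] as long as it stays inside. The time [/ (2 * K)] is the same for every starting
    point. *)
Lemma local_flow u0 v0 r K (S : R -> R -> R) : 0 < r -> 1 <= K -> lip_with (box u0 v0 r) K S ->
  forall u1 v1, exists V, V u1 = v1 /\
    (forall s, Rabs (s - u1) <= / (2 * K) -> Rabs (V s - v1) <= K * Rabs (s - u1)) /\
    (forall s, Rabs (s - u1) <= / (2 * K) -> box u0 v0 r s (V s) -> is_derive V s (S s (V s))).
Proof.
  intros Hr HK HS u1 v1.
  set (cu := clamp (u0 - r) (u0 + r)). set (cv := clamp (v0 - r) (v0 + r)).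
  assert (Cb : forall u v, box u0 v0 r (cu u) (cv v)).
  { intros u v. split; apply Rabs_le_between.
    - generalize (clamp_range (u0 - r) (u0 + r) u). unfold cu. lra.
    - generalize (clamp_range (v0 - r) (v0 + r) v). unfold cv. lra. }
  assert (k0 : 0 < / (2 * K)) by (apply Rinv_0_lt_compat; lra).
  destruct (picard_lindelof (fun u v => S (cu u) (cv v)) K K (/ (2 * K)) u1 v1) as (V & V1 & HV);
    try lra.
  - right. field. lra.
  - intros u v u' v'. destruct (HS _ _ (Cb u v)) as [_ H].
    eapply Rle_trans; [apply H, Cb|]. apply Rmult_le_compat_l; [lra|].
    apply Rplus_le_compat; apply clamp_lipschitz.
  - intros u v. apply HS, Cb.
  - exists V. split; auto. split.
    + intros s Hs. rewrite <- V1. apply mvt_bound0 with (fun u => S (cu u) (cv (V u))).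
      intros t Ht. split; [|apply HS, Cb]. apply HV. generalize (Rabs_between t u1 s Ht). lra.
    + intros s Hs [B1 B2]. replace (S s (V s)) with (S (cu s) (cv (V s))); [apply HV, Hs|].
      apply Rabs_le_between in B1, B2. unfold cu, cv. rewrite !clamp_id by lra. reflexivity.
Qed.

Lemma patch_Lip_le phi du dv u0 v0 r : patch phi du dv u0 v0 r ->
  contact (phi u0 v0) (dv u0 v0) <> 0 ->
  (px (leafdir phi du dv u0 v0) <> 0 \/ py (leafdir phi du dv u0 v0) <> 0) ->
  exists rho, 0 < rho /\
    Lip_le (fun p => exists i : R * R,
      (Rabs (fst i - u0) < rho /\ Rabs (snd i - v0) < rho) /\ phi (fst i) (snd i) = p) 40.
Proof.
  intros HP HB HW.
  destruct (patch_leaf_bounds _ _ _ _ _ _ HP HB)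
    as (r1 & K & Hr1 & HK & Bn & LS & LB & LX & LY & LXv & LYv).
  assert (HP1 := patch_sub _ _ _ _ _ _ r1 Hr1 HP).
  set (wx := px (leafdir phi du dv u0 v0)) in *. set (wy := py (leafdir phi du dv u0 v0)) in *.
  set (b := contact (phi u0 v0) (dv u0 v0)) in *.
  assert (b0 := Rabs_pos_lt _ HB).
  set (w1 := Rabs wx + Rabs wy). set (w2 := wx ^ 2 + wy ^ 2).
  assert (w20 : 0 < w2).
  { unfold w2. generalize (pow2_ge_0 wx) (pow2_ge_0 wy).
    destruct HW as [H|H]; apply pow_nonzero with (n := 2%nat) in H; lra. }
  (* The first five conditions are those of [adapted_of_estimates]. The sixth keeps the second label
     within the parameter range of the snowflake, the last keeps the leaves inside the box of radius
     [r1]. *)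
  destruct (exists_small [(80, 1); (400, w2); (40 * (w1 + 1), w2); (400 * K, Rabs b);
    (80 * (w1 + 2), Rabs b); (8 * Rabs b, 1); (1, r1)]) as (eps & He & C).
  { repeat constructor; simpl; lra. }
  repeat match goal with H : List.Forall _ (_ :: _) |- _ => inversion H; clear H; subst end.
  simpl fst in *. simpl snd in *.
  (* A leaf starting within [rho] and followed over [Rabs (s - u0) <= rho] moves by at most
     [2 * K * rho], so it stays in the box of radius [(1 + 2 * K) * rho]. There a [K]-Lipschitz
     quantity differs from its central value by at most [eps]. *)
  set (rho := eps / (2 * K * (1 + 2 * K))).
  assert (Hrho : 0 < rho) by (apply Rdiv_lt_0_compat; nra).
  assert (R2 : K * ((1 + 2 * K) * rho) = eps / 2) by (unfold rho; field; lra).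
  assert (R2' : (1 + 2 * K) * rho <= eps / 2) by nra.
  assert (R1 : K * rho * 4 <= eps) by nra.
  assert (Ra : 2 * rho <= / (2 * K)).
  { apply Rmult_le_reg_l with (2 * K); [lra|]. rewrite Rinv_r by lra. lra. }
  assert (E0 : box u0 v0 r1 u0 v0) by (apply box_center; lra).
  assert (near0 : forall u v, box u0 v0 ((1 + 2 * K) * rho) u v ->
            box u0 v0 r1 u v /\ K * (Rabs (u - u0) + Rabs (v - v0)) <= eps).
  { intros u v H. split; [eapply box_sub; [|exact H]; lra|]. destruct H. nra. }
  pose (V := fun i : R * R => proj1_sig (constructive_indefinite_description _
    (local_flow u0 v0 r1 K _ (proj1 Hr1) HK LS (fst i) (snd i)))).
  assert (HV : forall i, V i (fst i) = snd i /\
    (forall s, Rabs (s - fst i) <= / (2 * K) -> Rabs (V i s - snd i) <= K * Rabs (s - fst i)) /\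
    (forall s, Rabs (s - fst i) <= / (2 * K) -> box u0 v0 r1 s (V i s) ->
       is_derive (V i) s (slope phi du dv s (V i s)))).
  { intros i. exact (proj2_sig (constructive_indefinite_description _
    (local_flow u0 v0 r1 K _ (proj1 Hr1) HK LS (fst i) (snd i)))). }
  set (D := fun i : R * R => Rabs (fst i - u0) < rho /\ Rabs (snd i - v0) < rho).
  assert (VB : forall i s, D i -> Rabs (s - u0) <= rho -> Rabs (s - fst i) <= / (2 * K) /\
            box u0 v0 ((1 + 2 * K) * rho) s (V i s) /\
            is_derive (V i) s (slope phi du dv s (V i s))).
  { intros i s [D1 D2] Hs.
    assert (A : Rabs (s - fst i) <= 2 * rho).
    { replace (s - fst i) with ((s - u0) - (fst i - u0)) by ring.
      eapply Rle_trans; [apply Rabs_triang|]. rewrite Rabs_Ropp. lra. }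
    destruct (HV i) as (_ & V2 & V3). specialize (V2 s ltac:(lra)).
    assert (B : box u0 v0 ((1 + 2 * K) * rho) s (V i s)).
    { split; [nra|]. replace (V i s - v0) with ((V i s - snd i) + (snd i - v0)) by ring.
      eapply Rle_trans; [apply Rabs_triang|].
      assert (K * Rabs (s - fst i) <= K * (2 * rho)) by (apply Rmult_le_compat_l; lra). lra. }
    split; [lra|]. split; auto. apply V3; [lra|]. apply near0, B. }
  exists rho. split; auto.
  apply (Lip_le_of_adapted_coordinates (R * R) D (fun i => phi (fst i) (snd i))
    (fun i => sqrt w2 * fst i) (fun i => 4 * b * (V i u0 - v0))).
  - intros i Hi. destruct (VB i u0 Hi) as (_ & [_ B2] & _).
    { rewrite Rminus_diag, Rabs_R0. lra. }
    rewrite !Rabs_mult, (Rabs_pos_eq 4) by lra. nra.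
  - intros i j Hi Hj.
    replace (sqrt w2 * fst i - sqrt w2 * fst j) with (sqrt w2 * (fst i - fst j)) by ring.
    replace (4 * b * (V i u0 - v0) - 4 * b * (V j u0 - v0)) with (4 * b * (V i u0 - V j u0)) by ring.
    set (u := fst i). set (v := snd i). set (u' := fst j). set (v' := snd j).
    assert (Hu : Rabs (u - u0) < rho) by apply Hi. assert (Hu' : Rabs (u' - u0) < rho) by apply Hj.
    assert (Hv : Rabs (v - v0) < rho) by apply Hi.
    assert (Vj : V j u' = v') by apply HV. assert (Vi : V i u = v) by apply HV.
    destruct (VB j u Hj) as (_ & Bm & _); [lra|].
    assert (Bu : forall s, Rmin u' u <= s <= Rmax u' u -> Rabs (s - u0) <= rho).
    { intros s Hs. apply (box_between u0 v0 rho u' v0 u v0 s); auto;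
      split; try lra; rewrite Rminus_diag, Rabs_R0; lra. }
    assert (hh : Rabs (u - u') <= 2 * rho).
    { replace (u - u') with ((u - u0) - (u' - u0)) by ring.
      eapply Rle_trans; [apply Rabs_triang|]. rewrite Rabs_Ropp. lra. }
    assert (dd : Rabs (v - V j u) <= 2 * ((1 + 2 * K) * rho)).
    { destruct Bm as [_ Bm]. replace (v - V j u) with ((v - v0) - (V j u - v0)) by ring.
      eapply Rle_trans; [apply Rabs_triang|]. rewrite Rabs_Ropp. nra. }
    destruct HP1 as (_ & HD & (L1 & L2 & L3) & (L4 & L5 & L6)).
    assert (PX : has_partials u0 v0 r1 (fun u v => px (phi u v)) (fun u v => px (du u v)) (fun u v => px (dv u v))).
    { intros s t H. split; apply HD, H. }
    assert (PY : has_partials u0 v0 r1 (fun u v => py (phi u v)) (fun u v => py (du u v)) (fun u v => py (dv u v))).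
    { intros s t H. split; apply HD, H. }
    assert (PZ : has_partials u0 v0 r1 (fun u v => pz (phi u v)) (fun u v => pz (du u v)) (fun u v => pz (dv u v))).
    { intros s t H. split; apply HD, H. }
    destruct (horizontal_area (fun s => px (phi s (V j s))) (fun s => py (phi s (V j s)))
      (fun s => pz (phi s (V j s)))
      (fun s => px (du s (V j s)) + px (dv s (V j s)) * slope phi du dv s (V j s))
      (fun s => py (du s (V j s)) + py (dv s (V j s)) * slope phi du dv s (V j s))
      (fun s => pz (du s (V j s)) + pz (dv s (V j s)) * slope phi du dv s (V j s))
      wx wy eps u' u) as (X1 & Y1 & A1); [lra| |].
    { intros s Hs. destruct (VB j s Hj (Bu s Hs)) as (_ & B & DV).
      destruct (near0 _ _ B) as [B' Sm].
      assert (I1 : Rabs (s - u0) < r1) by (destruct B; lra).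
      assert (I2 : Rabs (V j s - v0) < r1) by (destruct B; lra).
      split; [exact (is_derive_along _ _ _ _ _ _ _ _ _ PX L1 L4 I1 I2 DV)|].
      split; [exact (is_derive_along _ _ _ _ _ _ _ _ _ PY L2 L5 I1 I2 DV)|].
      split; [exact (is_derive_along _ _ _ _ _ _ _ _ _ PZ L3 L6 I1 I2 DV)|].
      split; [|split].
      - assert (N := Bn _ _ B'). unfold slope.
        apply Rmult_eq_reg_r with (contact (phi s (V j s)) (dv s (V j s))); auto.
        apply Rminus_diag_uniq. revert N. unfold contact. intros N. field. intros E. apply N. lra.
      - assert (G := proj2 (LX _ _ B') _ _ E0). cbv beta in G. fold wx in G.
        replace (px (du s (V j s)) + px (dv s (V j s)) * slope phi du dv s (V j s))
          with (px (leafdir phi du dv s (V j s))) by (unfold leafdir, add3, scal3, px; simpl; ring).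
        lra.
      - assert (G := proj2 (LY _ _ B') _ _ E0). cbv beta in G. fold wy in G.
        replace (py (du s (V j s)) + py (dv s (V j s)) * slope phi du dv s (V j s))
          with (py (leafdir phi du dv s (V j s))) by (unfold leafdir, add3, scal3, py; simpl; ring).
        lra. }
    rewrite Vj in X1, Y1, A1.
    destruct (transverse_area (fun s => px (phi u s)) (fun s => py (phi u s)) (fun s => pz (phi u s))
      (fun s => px (dv u s)) (fun s => py (dv u s)) (fun s => pz (dv u s)) K b eps (V j u) v)
      as (X2 & Y2 & A2).
    { intros s Hs.
      assert (B : box u0 v0 ((1 + 2 * K) * rho) u s).
      { split; [apply Bm|]. apply (box_between u0 v0 ((1 + 2 * K) * rho) u (V j u) u v s); auto.
        split; [apply Bm|nra]. }
      destruct (near0 _ _ B) as [B' Sm].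
      split; [apply PX, B'|]. split; [apply PY, B'|]. split; [apply PZ, B'|].
      split; [|split; [apply LXv, B'|apply LYv, B']].
      assert (G := proj2 (LB _ _ B') _ _ E0). cbv beta in G. fold b in G. unfold contact in G at 1. lra. }
    (* The labels record the gap of the two leaves at [u0], the transverse step their gap at [u];
       this compares the two. *)
    assert (GR := gronwall_ratio (fun s => V i s - V j s)
      (fun s => slope phi du dv s (V i s) - slope phi du dv s (V j s)) K u0 u).
    cbv beta in GR. rewrite Vi in GR.
    assert (GR' : Rabs (v - V j u - (V i u0 - V j u0)) <= 2 * K * Rabs (u - u0) * Rabs (V i u0 - V j u0)).
    { apply GR; [lra|nra|]. intros s Hs.
      assert (Hs0 : Rabs (s - u0) <= rho) by (generalize (Rabs_between s u0 u Hs); lra).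
      destruct (VB i s Hi Hs0) as (_ & Bi & DVi). destruct (VB j s Hj Hs0) as (_ & Bj & DVj).
      split; [apply (is_derive_minus (V i) (V j)); auto|].
      assert (G := proj2 (LS _ _ (proj1 (near0 _ _ Bi))) _ _ (proj1 (near0 _ _ Bj))).
      rewrite Rminus_diag, Rabs_R0, Rplus_0_l in G. exact G. }
    apply (adapted_of_estimates (phi u v) (phi u (V j u)) (phi u' v') wx wy b (u - u') (v - V j u)
      (V i u0 - V j u0) eps K); fold w1 w2; try assumption; try lra.
    + apply Rle_trans with (K * (2 * rho)); [|lra]. apply Rmult_le_compat_l; lra.
    + apply Rle_trans with (K * (2 * ((1 + 2 * K) * rho))); [|lra]. apply Rmult_le_compat_l; lra.
    + eapply Rle_trans; [apply GR'|]. apply Rmult_le_compat_r; [apply Rabs_pos|].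
      apply Rle_trans with (2 * K * rho); [|lra]. apply Rmult_le_compat_l; lra.
Qed.

(** * Curves and surfaces *)

Lemma Lip_le_sub (U U' : pt -> Prop) L : (forall p, U p -> U' p) -> Lip_le U' L -> Lip_le U L.
Proof.
  intros H HL L' HL'. destruct (HL L' HL') as [f Hf]. exists f. intros a b Ha Hb. apply Hf; auto.
Qed.

Lemma Rabs_le_sqrt a s : a ^ 2 <= s -> Rabs a <= sqrt s.
Proof.
  intros H. rewrite <- sqrt_Rsqr_abs. apply sqrt_le_1_alt. unfold Rsqr. lra.
Qed.

Lemma dE3_components p q : Rabs (px p - px q) <= dE3 p q /\ Rabs (py p - py q) <= dE3 p q /\
  Rabs (pz p - pz q) <= dE3 p q.
Proof.
  unfold dE3. generalize (pow2_ge_0 (px p - px q)) (pow2_ge_0 (py p - py q)) (pow2_ge_0 (pz p - pz q)).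
  intros X Y Z. repeat split; apply Rabs_le_sqrt; lra.
Qed.

Lemma dE3_sym p q : dE3 p q = dE3 q p.
Proof. unfold dE3. f_equal. ring. Qed.

Lemma dE2_components u v u' v' : Rabs (u - u') <= dE2 u v u' v' /\ Rabs (v - v') <= dE2 u v u' v'.
Proof.
  unfold dE2. generalize (pow2_ge_0 (u - u')) (pow2_ge_0 (v - v')).
  intros X Y. split; apply Rabs_le_sqrt; lra.
Qed.

Lemma dE2_le u v u' v' : dE2 u v u' v' <= Rabs (u - u') + Rabs (v - v').
Proof.
  unfold dE2. assert (U := Rabs_pos (u - u')). assert (V := Rabs_pos (v - v')).
  rewrite <- (sqrt_pow2 (Rabs (u - u') + Rabs (v - v'))) by lra.
  apply sqrt_le_1_alt. rewrite <- (pow2_abs (u - u')), <- (pow2_abs (v - v')). nra.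
Qed.

Lemma patch_of_lipschitz phi du dv u0 v0 r K : 0 < r ->
  (forall u v, box u0 v0 r u v ->
     has_deriv3 (fun s => phi s v) u (du u v) /\ has_deriv3 (fun s => phi u s) v (dv u v)) ->
  (forall u v u' v', box u0 v0 r u v -> box u0 v0 r u' v' ->
     dE3 (du u v) (du u' v') <= K * (Rabs (u - u') + Rabs (v - v')) /\
     dE3 (dv u v) (dv u' v') <= K * (Rabs (u - u') + Rabs (v - v'))) ->
  patch phi du dv u0 v0 r.
Proof.
  intros Hr HD HK. split; [exact Hr|]. split; [exact HD|].
  split; (split; [|split]); apply lipb_of_lipschitz with K; try lra; intros u v u' v' H H';
  destruct (HK u v u' v' H H') as [H1 H2];
  [destruct (dE3_components (du u v) (du u' v')) as (C1 & C2 & C3)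
  |destruct (dE3_components (du u v) (du u' v')) as (C1 & C2 & C3)
  |destruct (dE3_components (du u v) (du u' v')) as (C1 & C2 & C3)
  |destruct (dE3_components (dv u v) (dv u' v')) as (C1 & C2 & C3)
  |destruct (dE3_components (dv u v) (dv u' v')) as (C1 & C2 & C3)
  |destruct (dE3_components (dv u v) (dv u' v')) as (C1 & C2 & C3)]; lra.
Qed.

(** * Tangent planes and the contact form *)

Definition independent (a b : pt) : Prop :=
  forall s t, add3 (scal3 s a) (scal3 t b) = pt0 -> s = 0 /\ t = 0.

Lemma add3_eq0 a b : px a + px b = 0 -> py a + py b = 0 -> pz a + pz b = 0 -> add3 a b = pt0.
Proof. intros H1 H2 H3. unfold add3. rewrite H1, H2, H3. reflexivity. Qed.

(** A leaf direction with zero projection would be vertical and in the kernel of the contact form,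
    hence zero, against independence. *)
Lemma leafdir_transversal phi du dv u v :
  contact (phi u v) (dv u v) <> 0 -> independent (du u v) (dv u v) ->
  px (leafdir phi du dv u v) <> 0 \/ py (leafdir phi du dv u v) <> 0.
Proof.
  intros HB HI. apply not_and_or. intros [H1 H2].
  set (k := slope phi du dv u v).
  assert (C : contact (phi u v) (du u v) + k * contact (phi u v) (dv u v) = 0).
  { unfold k, slope. field. exact HB. }
  unfold leafdir, add3, scal3 in H1, H2. unfold px at 1 in H1. unfold py at 1 in H2. simpl in H1, H2.
  unfold px at 2 in H1. unfold py at 2 in H2. simpl in H1, H2. fold k in H1, H2.
  destruct (HI 1 k) as [E _]; [|lra].
  apply add3_eq0; unfold scal3; cbn [px py pz fst snd]; unfold px, py, pz in *; simpl fst; simpl snd;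
  try lra.
  unfold contact, px, py, pz in C. nra.
Qed.

(** A vector in the kernel of the contact form is determined by its horizontal components.
    Independence thus makes their determinant nonzero, and Cramer's rule gives the coefficients. *)
Lemma span_horizontal p a b : contact p a = 0 -> contact p b = 0 -> independent a b ->
  forall w, span2 a b w <-> span2 (Xf p) (Yf p) w.
Proof.
  destruct p as [[x y] z], a as [[a1 a2] a3], b as [[b1 b2] b3].
  unfold contact, independent, span2, Xf, Yf, add3, scal3, px, py, pz, pt0.
  cbn [fst snd]. intros Ca Cb HI.
  assert (Ea : a3 = / 2 * (x * a2 - y * a1)) by lra.
  assert (Eb : b3 = / 2 * (x * b2 - y * b1)) by lra. subst a3 b3. clear Ca Cb.
  assert (Det : a1 * b2 - a2 * b1 <> 0).
  { intros Det.
    destruct (HI b1 (- a1)) as [B1 A1].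
    { apply f_equal2; [apply f_equal2; lra|].
      replace (b1 * (/ 2 * (x * a2 - y * a1)) + - a1 * (/ 2 * (x * b2 - y * b1)))
        with (- (/ 2 * x * (a1 * b2 - a2 * b1))) by ring. rewrite Det. ring. }
    destruct (HI b2 (- a2)) as [B2 A2].
    { apply f_equal2; [apply f_equal2; lra|].
      replace (b2 * (/ 2 * (x * a2 - y * a1)) + - a2 * (/ 2 * (x * b2 - y * b1)))
        with (- (/ 2 * y * (a1 * b2 - a2 * b1))) by ring. rewrite Det. ring. }
    destruct (HI 1 0) as [E _]; [|lra].
    assert (a1 = 0) by lra. assert (a2 = 0) by lra. subst.
    apply f_equal2; [apply f_equal2|]; ring. }
  intros w. split; intros (s & t & ->).
  - exists (s * a1 + t * b1), (s * a2 + t * b2). apply f_equal2; [apply f_equal2|]; field.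
  - exists ((s * b2 - t * b1) / (a1 * b2 - a2 * b1)), ((a1 * t - a2 * s) / (a1 * b2 - a2 * b1)).
    apply f_equal2; [apply f_equal2|]; field; exact Det.
Qed.

Lemma H_regular_chart M x : H_regular M x -> exists V W phi du dv u v,
  chart2 M V W phi du dv /\ W u v /\ phi u v = x /\
  (contact x (du u v) <> 0 \/ contact x (dv u v) <> 0).
Proof.
  intros HR. apply NNPP. intros N. apply HR. intros V W phi du dv u v HC HW Hx.
  apply span_horizontal.
  - apply NNPP. intros C. apply N. exists V, W, phi, du, dv, u, v. auto.
  - apply NNPP. intros C. apply N. exists V, W, phi, du, dv, u, v. auto.
  - intros s t. apply HC, HW.
Qed.

Lemma H_regular_parameter_nbhd M V W phi du dv u0 v0 : chart2 M V W phi du dv -> W u0 v0 ->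
  contact (phi u0 v0) (du u0 v0) <> 0 \/ contact (phi u0 v0) (dv u0 v0) <> 0 ->
  exists rho, 0 < rho /\ Lip_le (fun p => exists u v,
    Rabs (u - u0) < rho /\ Rabs (v - v0) < rho /\ phi u v = p) 40.
Proof.
  intros (OV & OW & HD & (K & HK) & HI & _) HW HC.
  destruct (OW u0 v0 HW) as (r & Hr & Hball).
  (* In the square of half-width [r / 3] the distance to the centre is at most [2 * r / 3 < r]. *)
  assert (HB : forall u v, box u0 v0 (r / 3) u v -> W u v).
  { intros u v [H1 H2]. apply Hball. eapply Rle_lt_trans; [apply dE2_le|]. lra. }
  assert (KL : forall u v u' v' , K * dE2 u v u' v' <= Rabs K * (Rabs (u - u') + Rabs (v - v'))).
  { intros u v u' v'. apply Rle_trans with (Rabs K * dE2 u v u' v').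
    - apply Rmult_le_compat_r; [apply sqrt_pos|apply Rle_abs].
    - apply Rmult_le_compat_l; [apply Rabs_pos|apply dE2_le]. }
  assert (Ind : independent (du u0 v0) (dv u0 v0)) by (intros s t; apply HI, HW).
  assert (HK' : forall u v u' v', box u0 v0 (r / 3) u v -> box u0 v0 (r / 3) u' v' ->
     dE3 (du u v) (du u' v') <= Rabs K * (Rabs (u - u') + Rabs (v - v')) /\
     dE3 (dv u v) (dv u' v') <= Rabs K * (Rabs (u - u') + Rabs (v - v'))).
  { intros u v u' v' H H'. generalize (HK u v u' v' (HB _ _ H) (HB _ _ H')) (KL u v u' v'). lra. }
  destruct (classic (contact (phi u0 v0) (dv u0 v0) <> 0)) as [HV|HV].
  - destruct (patch_Lip_le phi du dv u0 v0 (r / 3)) as (rho & Hrho & HL); auto.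
    + apply patch_of_lipschitz with (Rabs K); auto. lra.
    + apply leafdir_transversal; auto.
    + exists rho. split; auto. apply Lip_le_sub with (2 := HL).
      intros p (u & v & H1 & H2 & E). exists (u, v). auto.
  (* If only [du] is transverse to the horizontal plane, the two parameters exchange roles. *)
  - destruct HC as [HC|HC]; [|contradiction].
    destruct (patch_Lip_le (fun v u => phi u v) (fun v u => dv u v) (fun v u => du u v) v0 u0 (r / 3))
      as (rho & Hrho & HL); auto.
    + apply patch_of_lipschitz with (Rabs K); [lra| |].
      * intros u v [H1 H2]. split; apply HD, HB; split; auto.
      * intros u v u' v' [H1 H2] [H3 H4]. rewrite (Rplus_comm (Rabs (u - u'))).
        split; apply HK'; split; auto.
    + apply (leafdir_transversal (fun v u => phi u v) (fun v u => dv u v) (fun v u => du u v)); auto.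
      intros s t E. apply and_comm. apply Ind. rewrite <- E. unfold add3.
      apply f_equal2; [apply f_equal2|]; ring.
    + exists rho. split; auto. apply Lip_le_sub with (2 := HL).
      intros p (u & v & H1 & H2 & E). exists (v, u). auto.
Qed.

Lemma is_derive_add_const (f : R -> R) c t d : is_derive f t d -> is_derive (fun s => f s + c) t d.
Proof.
  intros H. replace d with (plus d zero) by apply plus_zero_r.
  apply (is_derive_plus f (fun _ => c)); auto. apply (is_derive_const c t).
Qed.

Lemma is_derive_const_add (c t : R) : is_derive (fun s => c + s) t 1.
Proof.
  replace 1 with (plus (zero : R_AbsRing) (one : R_AbsRing)) by apply plus_zero_l.
  apply (is_derive_plus (fun _ => c) (fun s => s)); [apply (is_derive_const c t)|apply (is_derive_id t)].
Qed.

(* The curve lies in a surface without characteristic points near the given one: its vertical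
   translates if the tangent is not vertical, and its translates along the first axis otherwise. *)
Lemma curve_parameter_nbhd gam V W phi dphi t0 : chart1 gam V W phi dphi -> W t0 ->
  exists rho, 0 < rho /\ Lip_le (fun p => exists t, Rabs (t - t0) < rho /\ phi t = p) 40.
Proof.
  intros (OV & OW & HD & (K & HK) & HN & _) HW.
  destruct (OW t0 HW) as (r & Hr & Hball).
  assert (HB : forall t, Rabs (t - t0) <= r / 2 -> W t) by (intros t Ht; apply Hball; lra).
  assert (HK' : forall s t, Rabs (s - t0) <= r / 2 -> Rabs (t - t0) <= r / 2 ->
            dE3 (dphi s) (dphi t) <= Rabs K * Rabs (s - t)).
  { intros s t Hs Ht. eapply Rle_trans; [apply HK; auto|].
    apply Rmult_le_compat_r; [apply Rabs_pos|apply Rle_abs]. }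
  assert (Z : forall p, dE3 p p = 0).
  { intros p. unfold dE3. rewrite !Rminus_diag. replace (_ + _) with 0 by ring. apply sqrt_0. }
  assert (KS : forall a b, 0 <= Rabs K * Rabs a /\ 0 <= Rabs K * Rabs b).
  { intros a b. split; apply Rmult_le_pos; apply Rabs_pos. }
  destruct (classic (px (dphi t0) <> 0 \/ py (dphi t0) <> 0)) as [HP|HP].
  - destruct (patch_Lip_le (fun u v => add3 (phi u) (0, 0, v)) (fun u v => dphi u)
      (fun u v => (0, 0, 1)) t0 0 (r / 2)) as (rho & Hrho & HL).
    + apply patch_of_lipschitz with (Rabs K); [lra| |].
      * intros u v [H1 H2]. destruct (HD u (HB u H1)) as (D1 & D2 & D3).
        split; (split; [|split]).
        -- apply (is_derive_add_const (fun s => px (phi s)) 0), D1.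
        -- apply (is_derive_add_const (fun s => py (phi s)) 0), D2.
        -- apply (is_derive_add_const (fun s => pz (phi s)) v), D3.
        -- apply (is_derive_const (px (phi u) + 0) v).
        -- apply (is_derive_const (py (phi u) + 0) v).
        -- apply (is_derive_const_add (pz (phi u)) v).
      * intros u v u' v' [H1 H2] [H3 H4]. rewrite Z.
        generalize (HK' u u' H1 H3) (KS (u - u') (v - v')). lra.
    + unfold contact, px, py, pz. simpl. lra.
    + unfold leafdir, add3, scal3, px, py, pz in *. simpl. rewrite Rmult_0_r, !Rplus_0_r. exact HP.
    + exists rho. split; auto. apply Lip_le_sub with (2 := HL).
      intros p (t & Ht & <-). exists (t, 0). simpl. rewrite Rminus_diag, Rabs_R0. split; auto.
      destruct (phi t) as [[a b] c]. unfold add3, px, py, pz. simpl. rewrite !Rplus_0_r. reflexivity.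
  - apply not_or_and in HP. destruct HP as [P1 P2]. apply NNPP in P1, P2.
    destruct (patch_Lip_le (fun u v => add3 (phi v) (u, 0, 0)) (fun u v => (1, 0, 0))
      (fun u v => dphi v) 0 t0 (r / 2)) as (rho & Hrho & HL).
    + apply patch_of_lipschitz with (Rabs K); [lra| |].
      * intros u v [H1 H2]. destruct (HD v (HB v H2)) as (D1 & D2 & D3).
        split; (split; [|split]).
        -- apply (is_derive_const_add (px (phi v)) u).
        -- apply (is_derive_const (py (phi v) + 0) u).
        -- apply (is_derive_const (pz (phi v) + 0) u).
        -- apply (is_derive_add_const (fun s => px (phi s)) u), D1.
        -- apply (is_derive_add_const (fun s => py (phi s)) 0), D2.
        -- apply (is_derive_add_const (fun s => pz (phi s)) 0), D3.
      * intros u v u' v' [H1 H2] [H3 H4]. rewrite Z.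
        generalize (HK' v v' H2 H4) (KS (u - u') (v - v')). lra.
    + unfold contact. rewrite P1, P2. intros E. apply (HN t0 HW).
      assert (P3 : pz (dphi t0) = 0) by lra.
      destruct (dphi t0) as [[a b] c]. unfold px, py, pz in P1, P2, P3. simpl in P1, P2, P3.
      subst. reflexivity.
    + left. unfold leafdir. unfold add3, scal3. unfold px at 1. simpl. unfold px at 2. simpl.
      rewrite P1, Rmult_0_r. unfold px. simpl. lra.
    + exists rho. split; auto. apply Lip_le_sub with (2 := HL).
      intros p (t & Ht & <-). exists (0, t). simpl. rewrite Rminus_diag, Rabs_R0. split; auto.
      destruct (phi t) as [[a b] c]. unfold add3, px, py, pz. simpl. rewrite !Rplus_0_r. reflexivity.
Qed.

Theorem theorem1p3 : exists L : R, 1 < L /\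
  (forall gam : pt -> Prop, C11_manifold1 gam ->
     forall x, gam x -> exists U, nbhd_in gam U x /\ Lip_le U L) /\
  (forall M : pt -> Prop, C11_manifold2 M ->
     forall x, M x -> H_regular M x -> exists U, nbhd_in M U x /\ Lip_le U L).
Proof.
  exists 40. split; [lra|]. split.
  - intros gam HG x Hx. destruct (HG x Hx) as (V & W & phi & dphi & HV & HC).
    assert (HC' := HC). destruct HC' as (OV & _ & _ & _ & _ & _ & Hsur & _ & Hcont).
    destruct (Hsur x Hx HV) as (t0 & Ht0 & E0).
    destruct (curve_parameter_nbhd _ _ _ _ _ _ HC Ht0) as (rho & Hrho & HL).
    (* Continuity of the inverse chart: points of [gam] close to [x] have parameters close to [t0],
       so the parameter interval covers a whole neighbourhood of [x] in [gam]. *)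
    destruct (Hcont t0 Ht0 rho Hrho) as (d & Hd & Hdist).
    destruct (OV x HV) as (r & Hr & Hball).
    exists (fun p => gam p /\ exists t, Rabs (t - t0) < rho /\ phi t = p). split; [split|].
    + intros p [Hp _]. exact Hp.
    + exists (Rmin r d). split; [apply Rmin_glb_lt; auto|]. intros p Hp Hxp.
      split; auto. destruct (Hsur p Hp) as (t & Ht & Et).
      { apply Hball. eapply Rlt_le_trans; [exact Hxp|apply Rmin_l]. }
      exists t. split; auto. apply Hdist; auto. rewrite Et, E0, dE3_sym.
      eapply Rlt_le_trans; [exact Hxp|apply Rmin_r].
    + apply Lip_le_sub with (2 := HL). intros p [_ Hp]. exact Hp.
  - intros M _ x Hx HR.
    destruct (H_regular_chart M x HR) as (V & W & phi & du & dv & u0 & v0 & HC & HW & E0 & Hc).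
    rewrite <- E0 in Hc.
    destruct (H_regular_parameter_nbhd _ _ _ _ _ _ _ _ HC HW Hc) as (rho & Hrho & HL).
    destruct HC as (OV & _ & _ & _ & _ & Hin & Hsur & _ & Hcont).
    destruct (Hcont u0 v0 HW rho Hrho) as (d & Hd & Hdist).
    assert (HV : V x) by (rewrite <- E0; apply Hin, HW).
    destruct (OV x HV) as (r & Hr & Hball).
    exists (fun p => M p /\ exists u v, Rabs (u - u0) < rho /\ Rabs (v - v0) < rho /\ phi u v = p).
    split; [split|].
    + intros p [Hp _]. exact Hp.
    + exists (Rmin r d). split; [apply Rmin_glb_lt; auto|]. intros p Hp Hxp.
      split; auto. destruct (Hsur p Hp) as (u & v & Huv & Euv).
      { apply Hball. eapply Rlt_le_trans; [exact Hxp|apply Rmin_l]. }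
      assert (G : dE2 u v u0 v0 < rho).
      { apply Hdist; auto. rewrite Euv, E0, dE3_sym.
        eapply Rlt_le_trans; [exact Hxp|apply Rmin_r]. }
      exists u, v. generalize (dE2_components u v u0 v0). repeat split; auto; lra.
    + apply Lip_le_sub with (2 := HL). intros p [_ Hp]. exact Hp.
Qed.
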